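(* Let $F:D(F)\subseteq\mathcal X\to\mathcal Y$, $f^\dagger$, $g^\dagger=F(f^\dagger)$, the Hilbert scale $\{\mathcal X_\nu\}_{\nu\in\mathbb R}$ and the indices $a,s,u$ satisfy the Basic Assumption, let the Conditional Stability Assumption hold with concave index function $\varphi$, and let the Stochastic Assumption (including its interpolation inequality) hold with Gelfand triple $(\mathcal V,\mathcal Y,\mathcal V')$, exponent $\theta\in(0,1)$ and radius $\rho>0$ (all three assumptions are spelled out in the context). Let the data be $g^{\mathrm{obs}}=g^\dagger+\sigma Z+\delta\xi$ with a centered Gaussian white noise $Z$ on $\mathcal Y$, a deterministic $\xi\in\mathcal Y$ with $\|\xi\|_{\mathcal Y}\le1$, and $\sigma,\delta>0$, and let $$\hat f_\alpha\in\operatorname*{argmin}_{f\in D(F)}\left[\tfrac12\|F(f)\|_{\mathcal Y}^2-\langle F(f),g^{\mathrm{obs}}\rangle+\alpha\|f\|_s^2\right].$$ Put $\psi_{u,s,a}(t):=\left(\varphi(\sqrt t)\right)^{\frac{2(u-s)}{a+u}}$ for $t\ge0$, $$\varphi_{\mathrm{app}}(\alpha)=(-\psi_{u,s,a})^*\left(-\tfrac1\alpha\right)=\sup_{\tau\ge0}\left[\psi_{u,s,a}(\tau)-\tfrac\tau\alpha\right],\qquad\alpha>0,$$ and $$\Sigma(\alpha)=\sqrt\alpha\,\sqrt{\varphi_{\mathrm{app}}(\alpha)},\qquad\widetilde\Sigma(\alpha)=\alpha^{1-\frac\theta2}\sqrt{\varphi_{\mathrm{app}}(\alpha)},\qquad\alpha>0.$$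 Let $\alpha$ be chosen such that $$\alpha\sim\Sigma^{-1}(\delta)+\widetilde\Sigma^{-1}(\sigma)\qquad\text{as }\max\{\delta,\sigma\}\to0,$$ and suppose that there are $\sigma_0,\delta_0>0$ such that $\hat f_\alpha\in D_\rho^s(f^\dagger)$ for all $0<\sigma\le\sigma_0$, $0<\delta\le\delta_0$. Then, almost surely, $$\|\hat f_\alpha-f^\dagger\|_s=\mathcal O\left(\sqrt{\varphi_{\mathrm{app}}\left(\Sigma^{-1}(\delta)+\widetilde\Sigma^{-1}(\sigma)\right)}\right)\qquad\text{as }\max\{\delta,\sigma\}\to0.$$
   Context: $\mathcal X$ (norm $\|\cdot\|$) and $\mathcal Y$ (norm $\|\cdot\|_{\mathcal Y}$) are infinite-dimensional separable real Hilbert spaces, $F:D(F)\subseteq\mathcal X\to\mathcal Y$ is a possibly nonlinear operator, and $f^\dagger\in D(F)$ is the unique solution of $F(f)=g$ for the exact right-hand side $g=g^\dagger=F(f^\dagger)$. The equation is assumed locally ill-posed at $f^\dagger$: for arbitrarily small $r>0$ there is a sequence $(f_n)\subset D(F)$ with $\|f_n-f^\dagger\|\le r$, $\liminf_n\|f_n-f^\dagger\|>0$ and $\|F(f_n)-F(f^\dagger)\|_{\mathcal Y}\to0$. Hilbert scale: $L:D(L)\subset\mathcal X\to\mathcal X$ is a densely defined, closed, unbounded, self-adjoint linear operator that is strictly positive, with $\|Lx\|\ge m\|x\|$ for all $x\in D(L)$ and some $m>0$. It generates the Hilbert scale $\mathcal X_\nu=D(L^\nu)$, $\nu\in\mathbb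 R$, $\mathcal X_0=\mathcal X$, with norms $\|x\|_\nu=\|L^\nu x\|$ (for $\nu<0$, completion of $\mathcal X$ in this norm). In the Tikhonov functional $\|f\|_s=\infty$ if $f\notin\mathcal X_s$. Balls: $D_\mu^\nu(\bar f)=\{f\in\mathcal X_\nu:\|f-\bar f\|_\nu\le\mu\}\cap D(F)$. Index function: a continuous, strictly increasing function $\varphi:[0,\infty)\to[0,\infty)$ with $\varphi(0)=0$. The notation $A\sim B$ means that $A/B$ is bounded above and below by positive constants in the indicated limit. The Fenchel conjugate is $h^*(y)=\sup_x[xy-h(x)]$, where functions defined on $[0,\infty)$ (here $-\psi_{u,s,a}$) are extended by $+\infty$ to negative arguments. Noise: a Hilbert space process $Z$ on $\mathcal Y$ is a bounded linear map $Z:\mathcal Y\to L^2(\Omega,\mathcal A,\mathbb P)$ for a probability space $(\Omega,\mathcal A,\mathbb P)$; one writes $\langle Z,g\rangle:=Z(g)$. It is centered if $\mathbb E\langle Z,g\rangle=0$ for all $g$, white if $\mathrm{Cov}[\langle Z,g_1\rangle,\langle Z,g_2\rangle]=\langle g_1,g_2\rangle$ for all $g_1,g_2$, and Gaussian if $(\langle Z,g_1\rangle,\dots,\langle Z,g_n\rangle)$ is multivariate Gaussian for all $g_1,\dots,g_n\in\mathcal Y$ and $n\in\mathbb N$. The data are understood weakly: for $g\in\mathcal Y$ one observes $\langle g^{\mathrm{obs}},g\rangle=\langle g^\dagger,g\rangle+\delta\langle g,\xi\rangle+\sigma\langle Z,g\rangle$. Since the embedding $\mathcal V\hookrightarrow\mathcal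 Y$ below is Hilbert--Schmidt, $Z$ can be regarded as a random element of $\mathcal V'$ with $\|Z\|_{\mathcal V'}<\infty$ almost surely, and $\langle Z,g\rangle$ for $g\in\mathcal V$ is the dual pairing. Basic Assumption: (a) $D(F)$ is a convex and closed subset of $\mathcal X$. (b) $F$ is weak-to-weak sequentially continuous: $x_n\rightharpoonup\bar x$ in $\mathcal X$ with $x_n\in D(F)$ and $\bar x\in D(F)$ implies $F(x_n)\rightharpoonup F(\bar x)$ in $\mathcal Y$. (c) There is $u>0$ with $f^\dagger\in\mathcal X_u$, where $f^\dagger\in D(F)$ is the unique solution of $F(f)=g$. (d) There are indices $a,s\in\mathbb R$ with $a\ge0$, $0\le s<u\le2s+a$ and $-a<s$. Conditional Stability Assumption: there are a concave index function $\varphi$, values $\theta_0\ge0$, $\rho_0>0$, $R>0$ and a subset $Q\subseteq D_{\rho_0}^{\theta_0}(f^\dagger)$ such that $\|f-f^\dagger\|_{-a}\le R\,\varphi(\|F(f)-F(f^\dagger)\|_{\mathcal Y})$ for all $f\in Q$, where $R$ may depend on $a$, $\varphi$ and $Q$. Stochastic Assumption: there is a Gelfand triple $(\mathcal V,\mathcal Y,\mathcal V')$ ($\mathcal V$ continuously and densely embedded in $\mathcal Y$, $\mathcal V'$ its dual, $\mathcal Y$ identified with its own dual) such that the embedding $\iota:\mathcal V\hookrightarrow\mathcal Y$ is Hilbert--Schmidt, and $F$ satisfies the interpolation inequality $$\|F(f)-g^\dagger\|_{\mathcal V}\le C_\theta(\rho)\,\|F(f)-g^\dagger\|_{\mathcal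 Y}^{\theta}\,\|f-f^\dagger\|_s^{1-\theta}\qquad\text{for all }f\in D_\rho^s(f^\dagger)$$ with some constant $C_\theta(\rho)$, $\rho>0$ and $\theta\in(0,1)$.
   Formalization: The formal theorem also assumes that the minimizers lie in the set Q of the Conditional Stability Assumption for all small noise levels; without this the claim is false, e.g. for Q consisting of the exact solution only, where the stability estimate holds for any index function. *)

(* Defs.v *)
From HB Require Import structures.
From mathcomp Require Import all_boot all_order all_algebra sesquilinear.
From mathcomp Require Import all_classical all_reals all_analysis.

Set Implicit Arguments.
Unset Strict Implicit.
Unset Printing Implicit Defensive.

Import Order.TTheory GRing.Theory Num.Theory.
Import numFieldNormedType.Exports.

Local Open Scope classical_set_scope.
Local Open Scope ring_scope.

Section hilbert.
Context {R : realType}.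

(* A real Hilbert space is a complete normed module X together with an inner
   product ip : {dot X for idfun} that induces its norm. *)
Definition is_hilbert (X : completeNormedModType R) (ip : {dot X for idfun}) :=
  forall x : X, `|x| ^+ 2 = ip x x.

Definition separable (X : topologicalType) :=
  exists2 D : set X, countable D & dense D.

Definition infinite_dimensional (X : lmodType R) :=
  forall (n : nat) (v : 'I_n -> X),
    exists x : X, forall c : 'I_n -> R, x <> \sum_(i < n) c i *: v i.

Definition weak_cvg (X : completeNormedModType R) (ip : {dot X for idfun})
    (x_ : nat -> X) (x : X) :=
  forall y : X, (fun n => ip (x_ n) y : R) @ \oo --> (ip x y : R).

Definition orthonormal_basis (X : completeNormedModType R)
    (ip : {dot X for idfun}) (e : nat -> X) :=
  (forall i j, ip (e i) (e j) = (i == j)%:R) /\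
  forall x : X, series (fun n => ip x (e n) *: e n) @ \oo --> x.

Definition hilbert_schmidt (V Y : completeNormedModType R)
    (ipV : {dot V for idfun}) (A : V -> Y) :=
  exists e : nat -> V, orthonormal_basis ipV e /\
    cvgn (series (fun n => `|A (e n)| ^+ 2 : R)).

End hilbert.

Section hilbert_scale.
Context {R : realType} {X : completeNormedModType R}.
Variable ip : {dot X for idfun}.

(* An unbounded operator is a pair (DL, L); the values of L outside DL are
   irrelevant. *)
Record scale_generator (DL : set X) (L : X -> X) : Prop := {
  generator_dom0 : DL 0 ;
  generator_domP : forall (c : R) x y, DL x -> DL y -> DL (c *: x + y) ;
  generator_linear : forall (c : R) x y, DL x -> DL y ->
    L (c *: x + y) = c *: L x + L y ;
  generator_dense : dense DL ;
  generator_closed : closed [set p : X * X | DL p.1 /\ p.2 = L p.1] ;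
  generator_unbounded :
    ~ exists C : R, forall x, DL x -> `|L x| <= C * `|x| ;
  generator_selfadjoint : forall y z,
    (forall x, DL x -> ip (L x) y = ip x z) <-> (DL y /\ z = L y) ;
  generator_positive : forall x, DL x -> x != 0 -> 0 < ip (L x) x ;
  generator_bounded_below :
    exists2 m : R, 0 < m & forall x, DL x -> m * `|x| <= `|L x| }.

(* Resolution of the identity: E l stands for E(]-oo, l]). *)
Record spectral_family (E : R -> X -> X) : Prop := {
  spectral_linear : forall l (c : R) x y, E l (c *: x + y) = c *: E l x + E l y ;
  spectral_symmetric : forall l x y, ip (E l x) y = ip x (E l y) ;
  spectral_mul : forall l k x, E l (E k x) = E (Num.min l k) x ;
  spectral_rcont : forall l x, E k x @[k --> l^'+] --> E l x ;
  spectral_ninfty : forall x, E k x @[k --> -oo] --> (0 : X) ;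
  spectral_pinfty : forall x, E k x @[k --> +oo] --> x }.

(* Riemann-Stieltjes sums of the spectral integral
   \int_0^oo lambda^nu dE_lambda x, over the dyadic partition of mesh 2^-n of
   ]2^-n, 2^n]. The spectrum of a scale generator lies in [m, +oo[ with m > 0,
   so no mass is lost by dropping ]-oo, 2^-n] in the limit. *)
Definition spectral_sum (E : R -> X -> X) (nu : R) (n : nat) (x : X) : X :=
  \sum_(1 <= k < 4 ^ n)
    ((k%:R / 2 ^+ n) `^ nu) *: (E (k.+1%:R / 2 ^+ n) x - E (k%:R / 2 ^+ n) x).

(* D(L^nu) and L^nu x for L = \int lambda dE_lambda. The sums defining L^nu x
   converge in X exactly if \int lambda^(2 nu) d<E_lambda x, x> is finite. *)
Definition hs_dom (E : R -> X -> X) (nu : R) : set X :=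
  [set x | cvgn (fun n => spectral_sum E nu n x)].

Definition lpow (E : R -> X -> X) (nu : R) (x : X) : X :=
  limn (fun n => spectral_sum E nu n x).

(* E is the spectral family of (DL, L), i.e. L = \int lambda dE_lambda; by the
   spectral theorem there is exactly one for every scale generator. *)
Definition spectral_family_of (E : R -> X -> X) (DL : set X) (L : X -> X) :=
  [/\ spectral_family E, DL = hs_dom E 1 & forall x, DL x -> L x = lpow E 1 x].

(* For nu < 0 the space X_nu is the completion of X in this norm; only its
   elements lying in X = hs_dom E nu are needed. *)
Definition hs_norm (E : R -> X -> X) (nu : R) (x : X) : R := `|lpow E nu x|.

(* the norm of X_nu, set to +oo outside X_nu *)
Definition hs_enorm (E : R -> X -> X) (nu : R) (x : X) : \bar R :=
  if `[< hs_dom E nu x >] then (hs_norm E nu x)%:E else +oo%E.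

Definition hs_ball (E : R -> X -> X) (DF : set X) (nu mu : R) (c : X) : set X :=
  [set f | hs_dom E nu f /\ (hs_enorm E nu (f - c)%R <= mu%:E)%E] `&` DF.

End hilbert_scale.

Section index_functions.
Context {R : realType}.

Definition index_function (phi : R -> R) :=
  [/\ {within `[0, +oo[, continuous phi},
      {in `[0, +oo[ &, {homo phi : x y / x < y}} & phi 0 = 0].

Definition concave_on_nonneg (phi : R -> R) :=
  forall x y t : R, 0 <= x -> 0 <= y -> 0 <= t <= 1 ->
    t * phi x + (1 - t) * phi y <= phi (t * x + (1 - t) * y).

Definition fenchel (h : R -> \bar R) (y : R) : \bar R :=
  ereal_sup (range (fun x : R => ((x * y)%:E - h x)%E)).

Definition extend_pinfty (h : R -> R) (t : R) : \bar R :=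
  if 0 <= t then (h t)%:E else +oo%E.

Definition psi (phi : R -> R) (u s a t : R) : R :=
  phi (Num.sqrt t) `^ (2 * (u - s) / (a + u)).

Definition phi_app (phi : R -> R) (u s a alpha : R) : R :=
  fine (fenchel (extend_pinfty (fun t => - psi phi u s a t)) (- alpha^-1)).

Definition Sigma (phi : R -> R) (u s a alpha : R) : R :=
  Num.sqrt alpha * Num.sqrt (phi_app phi u s a alpha).

Definition Sigma_tilde (phi : R -> R) (u s a theta alpha : R) : R :=
  alpha `^ (1 - theta / 2) * Num.sqrt (phi_app phi u s a alpha).

(* inverse of a function on ]0, +oo[ *)
Definition inv_pos (h : R -> R) : R -> R :=
  'pinv_(fun=> 0) [set alpha | 0 < alpha] h.

(* (delta, sigma) with delta, sigma > 0 and max{delta, sigma} -> 0 *)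
Definition vanishing_noise : set_system (R * R) :=
  within [set p | 0 < p.1 /\ 0 < p.2] (nbhs ((0, 0) : R * R)).

Definition same_order (G : set_system (R * R)) (A B : R * R -> R) :=
  exists c C : R, [/\ 0 < c, 0 < C & \forall p \near G, c <= A p / B p <= C].

End index_functions.

Section assumptions.
Context {R : realType} {X Y V : completeNormedModType R}.
Variables (ipX : {dot X for idfun}) (ipY : {dot Y for idfun})
  (ipV : {dot V for idfun}).
Variable E : R -> X -> X.
Variables (DF : set X) (F : X -> Y) (fdag : X).

Definition locally_ill_posed :=
  forall r : R, 0 < r -> exists f_ : nat -> X,
    [/\ forall n, DF (f_ n),
        forall n, `|f_ n - fdag| <= r,
        0 < limn_inf (fun n => `|f_ n - fdag| : R^o) &
        (fun n => `|F (f_ n) - F fdag|) @ \oo --> (0 : R)].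

Record basic_assumption (a s u : R) : Prop := {
  basic_convex : convex_set (DF : set (convex_lmodType X)) ;
  basic_closed : closed DF ;
  basic_weak : forall (x_ : nat -> X) (x : X),
    (forall n, DF (x_ n)) -> DF x ->
    weak_cvg ipX x_ x -> weak_cvg ipY (F \o x_) (F x) ;
  basic_u : 0 < u ;
  basic_smooth : hs_dom E u fdag ;
  basic_sol : DF fdag ;
  basic_unique : forall f, DF f -> F f = F fdag -> f = fdag ;
  basic_a : 0 <= a ;
  basic_s : 0 <= s < u ;
  basic_us : u <= 2 * s + a ;
  basic_as : - a < s }.

Record conditional_stability (a : R) (phi : R -> R) (Q : set X) : Prop := {
  stability_index : index_function phi ;
  stability_concave : concave_on_nonneg phi ;
  stability_subset : exists theta0 rho0 : R,
    [/\ 0 <= theta0, 0 < rho0 & Q `<=` hs_ball E DF theta0 rho0 fdag] ;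
  stability_estimate : exists2 K : R, 0 < K &
    forall f, Q f -> hs_norm E (- a) (f - fdag) <= K * phi `|F f - F fdag| }.

(* V is identified with its image under the embedding iota, so that
   |y|_V <= B means that y = iota v for some v with |v| <= B. *)
Record gelfand_triple (iota : {linear V -> Y}) : Prop := {
  gelfand_continuous : continuous iota ;
  gelfand_injective : injective iota ;
  gelfand_dense : dense (range iota) }.

Record stochastic_assumption (iota : {linear V -> Y}) (s theta rho : R)
    : Prop := {
  stochastic_gelfand : gelfand_triple iota ;
  stochastic_HS : hilbert_schmidt ipV iota ;
  stochastic_theta : 0 < theta < 1 ;
  stochastic_rho : 0 < rho ;
  stochastic_interpolation : exists C : R,
    forall f, hs_ball E DF s rho fdag f -> exists2 v : V,
      iota v = F f - F fdag &
      `|v| <= C * `|F f - F fdag| `^ theta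
                * hs_norm E s (f - fdag) `^ (1 - theta) }.

End assumptions.

Section noise.
Context {R : realType} {Y V : completeNormedModType R}.
Variable ipY : {dot Y for idfun}.
Context {d : measure_display} {T : measurableType d} (P : probability T R).

(* Z is a family of representatives of elements of L^2(P); linearity in L^2(P)
   is linearity up to a null set for each linear combination. *)
Record hilbert_process (Z : Y -> {RV P >-> R}) : Prop := {
  process_L2 : forall g, (Z g : T -> R) \in Lfun P 2%:E ;
  process_linear : forall (c : R) g h,
    {ae P, forall w, Z (c *: g + h) w = c * Z g w + Z h w} ;
  process_bounded : exists C : R, forall g,
    ('N[P]_2%:E[EFin \o Z g] <= (C * `|g|)%:E)%E }.

Definition centered (Z : Y -> {RV P >-> R}) := forall g, ('E_P[Z g] = 0)%E.

Definition white (Z : Y -> {RV P >-> R}) :=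
  forall g1 g2, covariance P (Z g1) (Z g2) = (ipY g1 g2)%:E.

(* normal_prob m 0 is not a point mass, whence the case distinction *)
Definition normal_law (X : T -> R) :=
  exists m s : R, forall A : set R, measurable A ->
    P (X @^-1` A) = if s == 0 then \d_m A else normal_prob m s A.

(* a random vector is multivariate Gaussian if all linear combinations of its
   components are (possibly degenerate) normal *)
Definition gaussian (Z : Y -> {RV P >-> R}) :=
  forall (n : nat) (g : 'I_n -> Y) (c : 'I_n -> R),
    normal_law (fun w => \sum_(i < n) c i * Z (g i) w).

(* A pathwise version z of Z: z w y is a representative of <Z, y> for every
   y in Y, and almost surely z w acts on V as an element zeta of the dual V'.
   As F fdag and F f need not lie in V (only their difference does),
   compatibility with zeta is required along all translates y + V. For a
   Hilbert-Schmidt embedding iota every process has such a version: take the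
   V'-valued one on V and extend it from one representative of each coset. *)
Definition pathwise_version (iota : V -> Y) (Z : Y -> {RV P >-> R})
    (z : T -> Y -> R) :=
  (forall y, {ae P, forall w, z w y = Z y w}) /\
  {ae P, forall w, exists zeta : {linear V -> R^o},
     [/\ continuous zeta, forall v, z w (iota v) = zeta v &
         forall y v, z w (y + iota v) = z w y + zeta v]}.

(* <g^obs, y> for g^obs = g + delta xi + sigma Z, z a realization of Z *)
Definition observed (g xi : Y) (delta sigma : R) (z : Y -> R) (y : Y) : R :=
  ipY g y + delta * ipY y xi + sigma * z y.

End noise.

Section tikhonov.
Context {R : realType} {X Y : completeNormedModType R}.

Definition tikhonov (E : R -> X -> X) (s : R) (F : X -> Y) (gobs : Y -> R)
    (alpha : R) (f : X) : \bar R :=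
  ((`|F f| ^+ 2 / 2 - gobs (F f))%:E + alpha%:E * hs_enorm E s f ^+ 2)%E.

Definition argmin (D : set X) (J : X -> \bar R) : set X :=
  [set f | D f /\ forall h, D h -> (J f <= J h)%E].

End tikhonov.

(* Main.v *)
Require Import Defs.
From mathcomp Require Import all_boot all_order all_algebra sesquilinear.
From mathcomp Require Import all_classical all_reals all_analysis.
From mathcomp Require Import ring lra zify.
Import Order.TTheory GRing.Theory Num.Theory.
Import numFieldNormedType.Exports.

(** Comparing the Tikhonov functional at the minimizer [f] and at [fdag], and
    completing the square in the misfit, gives for [r = |F f - F fdag|],
    [x = f - fdag] and [e = |x|_s]
      [r^2/2 + al e^2 <= del r + sig zeta(v) - 2 al <L^s fdag, L^s x>]
    where [F f - F fdag = iota v] and [zeta] is the realization of the noise.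
    Everything is pathwise: off a null set [zeta] is a bounded functional on
    [V], and its norm enters the constant of the final estimate. Three terms
    have to be absorbed.

    - The cross term is [<L^u fdag, L^(2s-u) x>], at most
      [|fdag|_u |x|_(2s-u)]. Interpolating the norm of order [2s-u] between the
      orders [-a], controlled by conditional stability, and [s] turns it into
      [e^2/4] plus a multiple of [psi (r^2)] ([smoothness_bound]); by definition
      of the Fenchel conjugate [psi (r^2) <= phi_app be + r^2/be] for every
      [be], and [be] proportional to [al] lets [r^2] be absorbed.
    - The deterministic noise [del r] costs [del^2] by Young's inequality.
    - The random noise is at most a multiple of [sig r^theta e^(1-theta)] by the
      interpolation inequality, and costs [sig^2 al^(theta-1)]
      ([young_interpolation]).

    Altogether [e^2] is at most a constant times
    [del^2/al + sig^2 al^(theta-2) + phi_app al] ([tikhonov_error]). The first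
    summand of the parameter choice balances the first of these terms with
    [phi_app], the second summand the second one ([parameter_choice_rate]). This
    uses that [phi_app] is finite, positive, increasing and that
    [phi_app (k al) <= k phi_app al] for [k >= 1]; hence it is continuous and
    [Sigma], [Sigma_tilde] map onto the positive half-line.

    The facts about the Hilbert scale are derived from the dyadic sums that
    define the powers of [L]. Increments of the spectral family are
    orthogonal, so each sum acts on them diagonally, and inequalities between
    powers pass from scalars to norms. The only analytic point is that
    [X_s] is contained in [X_nu] for [nu < s] ([hs_dom_lt]): as the spectrum
    is bounded away from 0, the sums for a negative power converge uniformly. *)

Set Implicit Arguments.
Unset Strict Implicit.
Unset Printing Implicit Defensive.

Local Open Scope classical_set_scope.
Local Open Scope ring_scope.

(** * Inner products and power functions *)

Section InnerProduct.
Context {R : realType} {X : completeNormedModType R}.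
Variable ip : {dot X for idfun}.
Hypothesis ipE : is_hilbert ip.

Lemma ip_sym x y : ip x y = ip y x.
Proof. by rewrite hermC /= expr0 mul1r. Qed.

Lemma normD_sqr x y : `|x + y| ^+ 2 = `|x| ^+ 2 + 2 * ip x y + `|y| ^+ 2.
Proof.
by rewrite !ipE linearDl !linearDr /= (ip_sym y x); ring.
Qed.

Lemma ip_polar x y : ip x y = (`|x + y| ^+ 2 - `|x| ^+ 2 - `|y| ^+ 2) / 2.
Proof. by rewrite normD_sqr; field. Qed.

Lemma ip_le_norm x y : ip x y <= `|x| * `|y|.
Proof.
have := normD_sqr x y; have := ler_normD x y.
have := normr_ge0 (x + y); have := normr_ge0 x; have := normr_ge0 y.
move: (ip x y) `|x + y| `|x| `|y| => i c a b b0 a0 c0 cab; nra.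
Qed.

(** By polarization this reduces to the continuity of the norm. *)
Lemma cvg_ip (f g : nat -> X) x y : f @ \oo --> x -> g @ \oo --> y ->
  (fun n => ip (f n) (g n) : R) @ \oo --> (ip x y : R).
Proof.
move=> fx gy; rewrite ip_polar.
have -> : (fun n => ip (f n) (g n)) = (fun n =>
    (`|f n + g n| ^+ 2 - `|f n| ^+ 2 - `|g n| ^+ 2) / 2).
  by apply/funext => n; rewrite ip_polar.
have sq (h : nat -> X) l : h @ \oo --> l ->
    (fun n => `|h n| ^+ 2 : R) @ \oo --> (`|l| ^+ 2 : R).
  move=> hl.
  exact: (continuous_cvg _ (@exprn_continuous R 2 `|l|) (cvg_norm hl)).
apply: cvgMr_tmp; apply: cvgB; last exact: sq.
by apply: cvgB; [apply: sq; exact: cvgD|exact: sq].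
Qed.

End InnerProduct.

(** The differences are dominated by a geometric sequence, hence summable. *)
Lemma cvg_of_geometric_increments {R : realType} {X : completeNormedModType R}
    (f : nat -> X) (C q : R) N :
  0 <= C -> 0 <= q < 1 ->
  (forall n, (N <= n)%N -> `|f n.+1 - f n| <= C * q ^+ n) -> cvgn f.
Proof.
move=> C0 /andP[q0 q1] fd.
suff : cvgn (fun n => f (n + N)%N).
  by move=> /cvg_ex[l fl]; apply/cvg_ex; exists l; rewrite -(cvg_shiftn N).
pose g n := f (n + N)%N.
have gE : g = (fun n => g 0%N + series (telescope g) n).
  apply/funext => n; elim: n => [|n ih].
    by rewrite seriesEnat/= big_geq ?addr0.
  by rewrite seriesSr addrA -ih /telescope addrC subrK.
rewrite -/g gE; apply: is_cvgD; first exact: is_cvg_cst.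
apply: normed_cvg.
apply: (@series_le_cvg _ _ (geometric C q)) => [n|n|n|] //=.
- by rewrite mulr_ge0// exprn_ge0.
- rewrite /telescope/= /g addSn (le_trans (fd _ (leq_addl _ _)))// ler_wpM2l//.
  by rewrite exprD ler_piMr ?exprn_ge0// exprn_ile1// ltW.
- by apply: is_cvg_geometric_series; rewrite ger0_norm.
Qed.

Section PowerFunction.
Context {R : realType}.
Implicit Types x y k : R.

(** Bernoulli's inequality for an integer exponent above [k]. *)
Lemma powR_bernoulli k : 0 <= k ->
  exists2 K : R, 0 <= K & forall t, 0 <= t <= 1 -> 1 - K * (1 - t) <= t `^ k.
Proof.
move=> k0; have [K kK] : exists K : nat, k <= K%:R.
  by exists (Num.truncn k).+1; rewrite ltW// truncnS_gt.
exists K%:R => [|t /andP[t0 t1]]; first exact: ler0n.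
apply: (@le_trans _ _ (t ^+ K)); last first.
  move: t0; rewrite le_eqVlt => /predU1P[<-|t0].
    have [K0|K0] := eqVneq K 0%N.
      have -> : k = 0 by apply/le_anti; rewrite k0 -(mulr0n 1) -K0 kK.
      by rewrite powRr0 K0 expr0.
    by rewrite expr0n (negPf K0) powR_ge0.
  by rewrite -powR_mulrn ?(ltW t0)// (ger_powR _ kK)// t0.
elim: K {kK} => [|K ih]; first by rewrite expr0 mul0r subr0.
rewrite exprS; apply: (@le_trans _ _ (t * (1 - K%:R * (1 - t)))); last first.
  exact: ler_wpM2l.
rewrite -subr_ge0.
have -> : t * (1 - K%:R * (1 - t)) - (1 - K.+1%:R * (1 - t))
    = K%:R * (1 - t) ^+ 2 by rewrite -natr1; ring.
by rewrite mulr_ge0 ?sqr_ge0 ?ler0n.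
Qed.

Lemma ler_powRN x y k : 0 < x -> x <= y -> 0 <= k -> y `^ (- k) <= x `^ (- k).
Proof.
move=> x0 xy k0; have y0 : 0 < y by exact: lt_le_trans xy.
by rewrite !powRN lef_pV2 ?posrE ?powR_gt0// ge0_ler_powR ?nnegrE// ltW.
Qed.

(** For [x <= y] the difference is [x^-k (1 - (x/y)^k)], and Bernoulli's
    inequality bounds the second factor by a multiple of [1 - x/y]. *)
Lemma powRN_lipschitz k c : 0 < c -> 0 <= k -> exists2 K : R, 0 <= K &
  forall x y, c <= x -> x <= y -> `|y `^ (- k) - x `^ (- k)| <= K * (y - x).
Proof.
move=> c0 k0; have [K K0 KP] := powR_bernoulli k0.
exists (c `^ (- k) * K / c) => [|x y cx xy].
  by rewrite mulr_ge0 ?invr_ge0 ?(ltW c0)// mulr_ge0// powR_ge0.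
have x0 : 0 < x by exact: lt_le_trans cx.
have y0 : 0 < y by exact: lt_le_trans xy.
rewrite distrC ger0_norm ?subr_ge0 ?ler_powRN//.
have -> : y `^ (- k) = x `^ (- k) * (x / y) `^ k.
  rewrite powRM ?invr_ge0 ?(ltW x0) ?(ltW y0)// mulrA powRN.
  rewrite [x `^ (- k)]powRN mulVf ?gt_eqF ?powR_gt0// mul1r -powRN.
  by rewrite -[y^-1]powR_inv1 ?(ltW y0)// -powRrM mulN1r.
rewrite -[X in X - _]mulr1 -mulrBr -2!mulrA.
apply: ler_pM; rewrite ?powR_ge0 ?ler_powRN// ?subr_ge0.
  have : (x / y) `^ k <= 1 `^ k; last by rewrite powR1.
  rewrite ge0_ler_powR ?nnegrE ?divr_ge0 ?(ltW x0) ?(ltW y0)//.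
  by rewrite ler_pdivrMr// mul1r.
have t1 : 0 <= x / y <= 1.
  by rewrite divr_ge0 ?(ltW x0) ?(ltW y0)//= ler_pdivrMr// mul1r.
have := KP _ t1; rewrite lerBlDr -lerBlDl => /le_trans; apply.
rewrite ler_wpM2l//.
have -> : 1 - x / y = y^-1 * (y - x) by rewrite mulrBr mulVf ?gt_eqF// mulrC.
by rewrite ler_wpM2r ?subr_ge0// lef_pV2 ?posrE// (le_trans cx).
Qed.

End PowerFunction.

(** * Step functions of a spectral family *)

Definition grid {R : realType} (n k : nat) : R := k%:R / 2 ^+ n.

Definition increment {R : realType} {X : completeNormedModType R}
    (E : R -> X -> X) (n k : nat) (x : X) : X :=
  E (grid n k.+1) x - E (grid n k) x.

(** The functional calculus for step functions: the operator [h(L)], where [h]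
    takes the value [c k] on the [k]-th cell of the level-[n] grid. *)
Definition step_op {R : realType} {X : completeNormedModType R}
    (E : R -> X -> X) (n : nat) (c : nat -> R) (x : X) : X :=
  \sum_(1 <= k < 4 ^ n) c k *: increment E n k x.

Section Grid.
Context {R : realType}.

Lemma grid_double n k : grid n.+1 k.*2 = grid n k :> R.
Proof. by rewrite /grid exprS -muln2 natrM; field; rewrite expf_neq0. Qed.

Lemma grid_double1 n k : grid n.+1 k.*2.+1 = grid n k + 2 ^- n.+1 :> R.
Proof.
rewrite /grid exprS -muln2 -natr1 natrM; field.
by rewrite expf_neq0.
Qed.

Lemma le_grid n : {mono @grid R n : j k / (j <= k)%N >-> j <= k}.
Proof. by move=> j k; rewrite ler_pM2r ?invr_gt0 ?exprn_gt0// ler_nat. Qed.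

Lemma lt_grid n : {mono @grid R n : j k / (j < k)%N >-> j < k}.
Proof. by move=> j k; rewrite ltr_pM2r ?invr_gt0 ?exprn_gt0// ltr_nat. Qed.

Lemma grid_gt0 n k : (0 < k)%N -> 0 < grid n k :> R.
Proof. by move=> k0; rewrite divr_gt0 ?ltr0n ?exprn_gt0. Qed.

Lemma gridS n k : grid n k.+1 = grid n k + 2 ^- n :> R.
Proof. by rewrite /grid -natr1; field; rewrite expf_neq0. Qed.

Lemma grid_half n j :
  @grid R n j./2 <= @grid R n.+1 j <= @grid R n j./2 + 2 ^- n.+1.
Proof.
rewrite -{2 3}(odd_double_half j); case: (odd j).
  by rewrite add1n grid_double1 lexx lerDl invr_ge0 exprn_ge0.
by rewrite add0n grid_double lexx lerDl invr_ge0 exprn_ge0.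
Qed.

(** The cells of level [n.+1] that start at or after this point lie to the
    right of the level-[n] grid. *)
Lemma grid_last n : grid n.+1 (2 * 4 ^ n) = 2 ^+ n :> R.
Proof.
have -> : (4 ^ n = 2 ^ n * 2 ^ n)%N by rewrite -expnMn.
by rewrite mul2n grid_double /grid natrM natrX mulfK ?expf_neq0.
Qed.

End Grid.

Section SpectralFamily.
Context {R : realType} {X : completeNormedModType R}.
Variable ip : {dot X for idfun}.
Hypothesis ipE : is_hilbert ip.
Variable E : R -> X -> X.
Hypothesis hE : spectral_family ip E.

Lemma spectral_sumE nu n x :
  spectral_sum E nu n x = step_op E n (fun k => grid n k `^ nu) x.
Proof. by []. Qed.

Lemma incrementP n k (c : R) x y :
  increment E n k (c *: x + y) = c *: increment E n k x + increment E n k y.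
Proof.
by rewrite /increment !(spectral_linear hE) scalerBr opprD addrACA.
Qed.

Lemma increment0 n k : increment E n k 0 = 0.
Proof.
have := incrementP n k (-1) 0 0; rewrite scaler0 addr0 => ->.
by rewrite scaleN1r addNr.
Qed.

Lemma increment_sum n k N c x :
  increment E n k (\sum_(1 <= j < N) c j *: increment E n j x)
  = \sum_(1 <= j < N) c j *: increment E n k (increment E n j x).
Proof.
elim: N => [|N ih]; first by rewrite !big_geq ?increment0.
have [N0|N0] := leqP 1 N; last by rewrite !big_geq ?increment0.
by rewrite !big_nat_recr//= addrC incrementP ih addrC.
Qed.

Lemma increment_comp n j k x :
  increment E n j (increment E n k x) = if j == k then increment E n k x else 0.
Proof.
have EB l y z : E l (y - z) = E l y - E l z.
  by rewrite -scaleN1r addrC (spectral_linear hE) scaleN1r addrC.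
rewrite /increment !EB !(spectral_mul hE).
have minE i h : Num.min (grid n i) (grid n h) = grid n (minn i h) :> R.
  by rewrite minElt lt_grid /minn; case: ifP.
rewrite !minE; have [->|jk] := eqVneq j k.
  rewrite !minnn (minn_idPr (leqnSn k)) (minn_idPl (leqnSn k)).
  by rewrite (subrr (E (grid n k) x)) subr0.
have [lt|lt] : (j < k)%N \/ (k < j)%N by lia.
  have [-> -> -> ->] : [/\ minn j.+1 k.+1 = j.+1, minn j.+1 k = j.+1,
    minn j k.+1 = j & minn j k = j] by split; lia.
  by rewrite !subrr.
have [-> -> -> ->] : [/\ minn j.+1 k.+1 = k.+1, minn j.+1 k = k,
  minn j k.+1 = k.+1 & minn j k = k] by split; lia.
by rewrite subrr.
Qed.

Lemma increment_sym n k x y :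
  ip (increment E n k x) y = ip x (increment E n k y).
Proof.
rewrite /increment linearBl linearBr/=; congr (_ - _);
  exact: spectral_symmetric hE _ _ _.
Qed.

Lemma increment_orthogonal n j k x y :
  ip (increment E n j x) (increment E n k y) =
  if j == k then ip (increment E n k x) (increment E n k y) else 0.
Proof.
case: eqP => [->//|/eqP/negPf jk].
by rewrite increment_sym increment_comp jk linear0r.
Qed.

Lemma step_opP n c (a : R) x y :
  step_op E n c (a *: x + y) = a *: step_op E n c x + step_op E n c y.
Proof.
rewrite /step_op scaler_sumr -big_split/=; apply: eq_bigr => k _.
by rewrite incrementP scalerDr !scalerA mulrC.
Qed.

Lemma step_opB n c x y :
  step_op E n c (x - y) = step_op E n c x - step_op E n c y.
Proof. by rewrite addrC -scaleN1r step_opP scaleN1r addrC. Qed.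

Lemma sub_step_op n c c' x :
  step_op E n c x - step_op E n c' x = step_op E n (fun k => c k - c' k) x.
Proof.
by rewrite /step_op -sumrB; apply: eq_bigr => k _; rewrite scalerBl.
Qed.

Lemma step_op_comp n c c' x :
  step_op E n c (step_op E n c' x) = step_op E n (fun k => c k * c' k) x.
Proof.
rewrite /step_op; apply: eq_big_nat => k kn.
rewrite increment_sum (big_rem k)/=; last by rewrite mem_index_iota.
rewrite increment_comp eqxx scalerDr scalerA big1_seq ?scaler0 ?addr0//.
move=> j /andP[_]; rewrite mem_rem_uniq ?iota_uniq// inE => /andP[jk _].
by rewrite increment_comp eq_sym (negPf jk) scaler0.
Qed.

Lemma ip_step_op n c c' x y : ip (step_op E n c x) (step_op E n c' y) =
  \sum_(1 <= k < 4 ^ n) c k * c' k * ip (increment E n k x) (increment E n k y).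
Proof.
rewrite /step_op linear_sumlz/=; apply: eq_big_nat => k kn.
rewrite linear_sumr/= (big_rem k)/=; last by rewrite mem_index_iota.
rewrite linearZl_LR linearZr_LR/= mulrA big1_seq ?addr0//.
move=> j /andP[_]; rewrite mem_rem_uniq ?iota_uniq// inE => /andP[jk _].
rewrite linearZl_LR linearZr_LR/= increment_orthogonal.
by rewrite eq_sym (negPf jk) !mulr0.
Qed.

Lemma norm_step_op n c x : `|step_op E n c x| ^+ 2 =
  \sum_(1 <= k < 4 ^ n) c k ^+ 2 * `|increment E n k x| ^+ 2.
Proof. by rewrite ipE ip_step_op; apply: eq_bigr => k _; rewrite ipE. Qed.

(** Bessel: [step_op E n (fun=> 1)] is an orthogonal projection. *)
Lemma sum_increment_le n x :
  \sum_(1 <= k < 4 ^ n) `|increment E n k x| ^+ 2 <= `|x| ^+ 2.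
Proof.
have p1 : `|step_op E n (fun=> 1) x| ^+ 2 =
    \sum_(1 <= k < 4 ^ n) `|increment E n k x| ^+ 2.
  by rewrite norm_step_op; apply: eq_bigr => k _; rewrite expr1n mul1r.
have p2 : ip (step_op E n (fun=> 1) x) x =
    \sum_(1 <= k < 4 ^ n) `|increment E n k x| ^+ 2.
  rewrite /step_op linear_sumlz/=; apply: eq_bigr => k _.
  rewrite scale1r ipE increment_sym increment_sym.
  by rewrite increment_comp eqxx.
rewrite -p1; apply: lerXn2r; rewrite ?nnegrE//.
have := ip_le_norm ipE (step_op E n (fun=> 1) x) x; rewrite p2 -p1 expr2.
have := normr_ge0 (step_op E n (fun=> 1) x).
by rewrite le_eqVlt => /predU1P[<-//|p0]; rewrite ler_pM2l.
Qed.

(** By Bessel's inequality only the cells charged by [x] count. *)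
Lemma step_op_le n c x M : 0 <= M ->
  (forall k, (1 <= k < 4 ^ n)%N -> increment E n k x != 0 -> `|c k| <= M) ->
  `|step_op E n c x| <= M * `|x|.
Proof.
move=> M0 cM; rewrite -(@ler_pXn2r _ 2) ?nnegrE ?mulr_ge0//.
rewrite norm_step_op exprMn.
apply: le_trans (ler_wpM2l (sqr_ge0 M) (sum_increment_le n x)).
rewrite mulr_sumr; apply: ler_sum_nat => k kn.
have [->|/(cM k kn) ckM] := eqVneq (increment E n k x) 0.
  by rewrite normr0 expr0n !mulr0.
rewrite ler_wpM2r ?sqr_ge0// -[c k ^+ 2]real_normK ?num_real//.
by rewrite lerXn2r ?nnegrE.
Qed.

Lemma increment_split n k x :
  increment E n k x = increment E n.+1 k.*2 x + increment E n.+1 k.*2.+1 x.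
Proof.
by rewrite /increment -doubleS !grid_double [RHS]addrC addrA subrK.
Qed.

(** The values on the level-[n.+1] cells of the step function that is [c] at
    level [n]: cell [j] lies in its parent [j./2], unless it is outside
    [ ]2^-n, 2^n] ], where level [n] is cut off. *)
Definition refine (n : nat) (c : nat -> R) (j : nat) : R :=
  if (2 <= j < 2 * 4 ^ n)%N then c j./2 else 0.

Lemma step_op_refine n c x : step_op E n c x = step_op E n.+1 (refine n c) x.
Proof.
pose g j := c j./2 *: increment E n.+1 j x.
have sumE N : (0 < N)%N ->
    \sum_(1 <= k < N) c k *: increment E n k x = \sum_(2 <= j < N.*2) g j.
  elim: N => // N ih _; have [->|N0] := posnP N; first by rewrite !big_geq.
  rewrite big_nat_recr//= ih// doubleS.
  rewrite (@big_nat_recr _ _ _ N.*2.+1)/=; last by lia.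
  rewrite (@big_nat_recr _ _ _ N.*2)/=; last by lia.
  rewrite -addrA; congr (_ + _).
  by rewrite increment_split scalerDr /g/= !doubleK ?uphalf_double.
rewrite /step_op sumE ?expn_gt0//.
have n1 : (1 <= 4 ^ n)%N by rewrite expn_gt0.
rewrite (@big_cat_nat _ _ _ 2 1 (4 ^ n.+1))//=; last by rewrite expnS; lia.
rewrite big_nat1 /refine/= scale0r add0r.
rewrite (@big_cat_nat _ _ _ (4 ^ n).*2 2 (4 ^ n.+1))//=;
  [|lia|by rewrite expnS; lia].
rewrite [X in _ = _ + X]big_nat [X in _ = _ + X]big1 ?addr0.
  by apply: eq_big_nat => j jn; rewrite mul2n jn.
by move=> j /andP[nj _]; rewrite mul2n [(j < _)%N]ltnNge nj andbF scale0r.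
Qed.

Lemma step_op_succB n c c' x : step_op E n.+1 c' x - step_op E n c x =
  step_op E n.+1 (fun j => c' j - refine n c j) x.
Proof. by rewrite (step_op_refine n) sub_step_op. Qed.

Lemma spectral_sumM nu mu n x :
  spectral_sum E (nu + mu) n x = spectral_sum E nu n (spectral_sum E mu n x).
Proof.
rewrite !spectral_sumE step_op_comp; apply: eq_big_nat => k /andP[k0 _].
by rewrite powRD//; apply/implyP => _; rewrite gt_eqF// grid_gt0.
Qed.

End SpectralFamily.

(** * The Hilbert scale *)

Lemma near_expr2N_le {R : realType} (c : R) : 0 < c ->
  exists N, forall n, (N <= n)%N -> 2 ^- n <= c.
Proof.
move=> c0; exists (Num.truncn c^-1).+1 => n nN.
rewrite invf_ple ?posrE ?exprn_gt0//.
apply: (@le_trans _ _ n%:R); last by rewrite -natrX ler_nat ltnW// ltn_expl.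
by apply: le_trans (ltW (truncnS_gt _)) _; rewrite ler_nat.
Qed.

Lemma cvg_norm_le {R : realType} {X : completeNormedModType R}
    (f : nat -> X) x (M : R) :
  f @ \oo --> x -> (forall n, `|f n| <= M) -> `|x| <= M.
Proof.
move=> /cvg_norm fx fM; rewrite -(cvg_lim _ fx)//.
by apply: limr_le; [exact: cvgP fx|exact: nearW].
Qed.

Section BottomOfSpectrum.
Context {R : realType} {X : completeNormedModType R}.
Variable ip : {dot X for idfun}.
Hypothesis ipE : is_hilbert ip.
Variables (DL : set X) (L : X -> X) (E : R -> X -> X).
Hypothesis hL : scale_generator ip DL L.
Hypothesis hE : spectral_family_of ip E DL L.

Let famE : spectral_family ip E. Proof. by case: hE. Qed.

Lemma increment_below n k l x : l <= grid n k -> increment E n k (E l x) = 0.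
Proof.
move=> lk; rewrite /increment !(spectral_mul famE) !(min_idPr _) ?subrr//.
by rewrite (le_trans lk)// le_grid.
Qed.

Lemma spectral_sum1_below n l x :
  `|spectral_sum E 1 n (E l x)| <= Num.max 0 l * `|E l x|.
Proof.
rewrite spectral_sumE; apply: (step_op_le ipE famE) => [|k /andP[k0 _] kl].
  by rewrite le_max lexx.
rewrite powRr1 ?(ltW (grid_gt0 _ _))// ger0_norm ?(ltW (grid_gt0 _ _))//.
rewrite le_max; apply/orP; right; rewrite leNgt; apply/negP => lk.
by move/eqP: kl; apply; apply: increment_below; exact: ltW.
Qed.

(** [E l x] has no increments above [l], so once [2^n >= l] the levels [n] and
    [n.+1] differ only by the mesh. *)
Lemma spectral_sum1_cvg_below l x : cvgn (fun n => spectral_sum E 1 n (E l x)).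
Proof.
have [N NP] : exists N, forall n, (N <= n)%N -> l <= 2 ^+ n.
  have [l0|l0] := lerP l 0.
    by exists 0%N => n _; rewrite (le_trans l0)// exprn_ge0.
  have [|N NP] := @near_expr2N_le _ l^-1; first by rewrite invr_gt0.
  by exists N => n /NP; rewrite lef_pV2 ?posrE ?exprn_gt0.
apply: (@cvg_of_geometric_increments _ _ _ `|E l x| 2^-1 N) => //.
  by rewrite invr_ge0 ler0n invf_lt1// ltr1n.
move=> n /NP nl; rewrite !spectral_sumE step_op_succB mulrC exprVn.
apply: (step_op_le ipE famE) => [|j /andP[j0 _] jl].
  by rewrite invr_ge0 exprn_ge0.
rewrite /refine; case: ifPn => [/andP[j2 jn]|jn].
  rewrite !powRr1 ?(ltW (grid_gt0 _ _))//; last by lia.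
  have /andP[h1 h2] := @grid_half R n j.
  rewrite ger0_norm ?subr_ge0// lerBlDl (le_trans h2)// lerD2l.
  by rewrite lef_pV2 ?posrE ?exprn_gt0// ler_eXn2l// ltr1n.
rewrite subr0 powRr1 ?(ltW (grid_gt0 _ _))// ger0_norm ?(ltW (grid_gt0 _ _))//.
have [j2|j2] := leqP 2 j.
  move/eqP: jl; case; apply: increment_below; apply: (le_trans nl).
  by rewrite -grid_last le_grid leqNgt; apply: contra jn => ->; rewrite j2.
have -> : j = 1%N by lia.
by rewrite /grid mul1r lef_pV2 ?posrE ?exprn_gt0// ler_eXn2l// ltr1n.
Qed.

(** On the range of [E l] the operator [L] is bounded by [max 0 l], which
    contradicts [m |x| <= |L x|] when [l < m]; so the spectrum starts at [m]. *)
Lemma spectral_bottom : exists2 m : R, 0 < m & forall l x, l < m -> E l x = 0.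
Proof.
have [m m0 mL] := generator_bounded_below hL; exists m => // l x lm.
have [_ DLE LE] := hE.
have cv := @spectral_sum1_cvg_below l x.
have DLx : DL (E l x) by rewrite DLE.
have := mL _ DLx; rewrite LE// => h1.
have h2 : `|lpow E 1 (E l x)| <= Num.max 0 l * `|E l x|.
  by apply: (cvg_norm_le cv) => n; exact: spectral_sum1_below.
have h3 : Num.max 0 l < m by rewrite gt_max m0.
have := le_trans h1 h2; rewrite -subr_le0 -mulrBl pmulr_rle0 ?subr_gt0//.
by rewrite normr_le0 => /eqP.
Qed.

End BottomOfSpectrum.

Section HilbertScale.
Context {R : realType} {X : completeNormedModType R}.
Variable ip : {dot X for idfun}.
Hypothesis ipE : is_hilbert ip.
Variable E : R -> X -> X.
Hypothesis famE : spectral_family ip E.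
Variable m : R.
Hypothesis m0 : 0 < m.
Hypothesis Em : forall l x, l < m -> E l x = 0.

Lemma increment_support n k x : increment E n k x != 0 -> m <= grid n k.+1.
Proof.
apply: contraNT; rewrite -ltNge => km; rewrite /increment !Em ?subrr//.
by apply: lt_trans km; rewrite lt_grid.
Qed.

(** The left end of a cell misses its right end by the mesh; the additional
    [2^-n] lets the bound pass to the parent cell. *)
Lemma increment_support_half : exists N, forall n k x, (N <= n)%N ->
  increment E n k x != 0 -> m / 2 + 2 ^- n <= grid n k.
Proof.
have [|N NP] := @near_expr2N_le _ (m / 4); first by rewrite divr_gt0.
exists N => n k x /NP nm /increment_support; rewrite gridS; lra.
Qed.

Lemma spectral_sumN_bounded k : 0 <= k -> exists M N, 0 <= M /\
  forall n x, (N <= n)%N -> `|spectral_sum E (- k) n x| <= M * `|x|.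
Proof.
move=> k0; have [N NP] := increment_support_half.
exists ((m / 2) `^ (- k)), N; split; first exact: powR_ge0.
move=> n x nN; rewrite spectral_sumE; apply: (step_op_le ipE famE).
  exact: powR_ge0.
move=> j _ /(NP _ _ _ nN) jm; rewrite ger0_norm ?powR_ge0//.
rewrite ler_powRN ?divr_gt0// (le_trans _ jm)// lerDl.
by rewrite invr_ge0 exprn_ge0.
Qed.

(** The functions [l `^ - k] are uniformly continuous on the spectrum and small
    near infinity, so the step functions approximating them converge uniformly
    there, at a geometric rate. *)
Lemma spectral_sumN_cvg k x : 0 < k -> cvgn (fun n => spectral_sum E (- k) n x).
Proof.
move=> k0; have m20 : 0 < m / 2 by rewrite divr_gt0.
have [K K0 KP] := powRN_lipschitz m20 (ltW k0).
have [N NP] := increment_support_half.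
pose r : R := 2 `^ (- k).
have r1 : r < 1.
  rewrite /r powRN invf_lt1 ?powR_gt0//.
  have : 1 `^ k < 2 `^ k :> R; last by rewrite powR1.
  by rewrite gt0_ltr_powR ?nnegrE// ltr1n.
have r0 : 0 <= r by exact: powR_ge0.
pose q := Num.max r 2^-1.
have q0 : 0 <= q < 1 by rewrite le_max r0 gt_max r1 invf_lt1// ltr1n.
apply: (@cvg_of_geometric_increments _ _ _ ((1 + K) * `|x|) q N.+1) => //.
  by rewrite mulr_ge0// addr_ge0.
move=> n nN; rewrite !spectral_sumE step_op_succB mulrAC.
case/andP: q0 => q0 _.
apply: (step_op_le ipE famE) => [|j /andP[j0 _] jx].
  by rewrite mulr_ge0 ?exprn_ge0// addr_ge0.
have jm := NP _ _ _ (ltnW (leqW nN) : (N <= n.+1)%N) jx.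
rewrite mulrDl mul1r /refine; case: ifPn => [/andP[j2 jn]|jn].
  (* inside the level-[n] grid: the Lipschitz bound gives the rate 1/2 *)
  have /andP[h1 h2] := @grid_half R n j.
  have jm' : m / 2 <= grid n j./2.
    by rewrite -(lerD2r (2 ^- n.+1)) (le_trans jm).
  apply: (le_trans (KP _ _ jm' h1)).
  rewrite -[leLHS]add0r lerD ?exprn_ge0//; apply: ler_wpM2l => //.
  rewrite lerBlDl (le_trans h2)// lerD2l -exprVn.
  apply: (@le_trans _ _ (2^-1 ^+ n)).
    by rewrite exprS ler_piMl ?exprn_ge0 ?invr_ge0// invf_le1// ler1n.
  by rewrite lerXn2r ?nnegrE ?invr_ge0// le_max lexx orbT.
(* the new cells: those at the left end are off the spectrum, those at the right
   end lie beyond [2^n], where the power is at most [r ^+ n] *)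
rewrite subr0 ger0_norm ?powR_ge0//.
apply: (@le_trans _ _ (r ^+ n)); last first.
  rewrite -[leLHS]addr0 lerD ?mulr_ge0 ?exprn_ge0//.
  by rewrite lerXn2r ?nnegrE// le_max lexx.
have -> : r ^+ n = (2 ^+ n) `^ (- k).
  by rewrite -powR_mulrn// -powRrM mulrC powRrM powR_mulrn.
apply: ler_powRN (ltW k0); first by rewrite exprn_gt0.
rewrite -grid_last le_grid leqNgt; apply: contra jn => ->; rewrite andbT.
case: j j0 jm {jx} => [//|[|//]] _.
by rewrite /grid mul1r gerDr leNgt divr_gt0.
Qed.

(** [L^nu = L^(nu - s) L^s], and the sums for [L^(nu - s)] are uniformly
    bounded and converge strongly. *)
Lemma hs_dom_lt nu s x : nu < s -> hs_dom E s x -> hs_dom E nu x.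
Proof.
move=> nus xs.
pose k := s - nu; have k0 : 0 < k by rewrite subr_gt0.
have [M [N [M0 MN]]] := spectral_sumN_bounded (ltW k0).
pose y := lpow E s x; pose S n := spectral_sum E s n x.
have Sy : S @ \oo --> y by exact: xs.
have By := spectral_sumN_cvg (x := y) k0.
apply/cvg_ex; exists (limn (fun n => spectral_sum E (- k) n y) + 0).
have -> : (fun n => spectral_sum E nu n x) = (fun n =>
    spectral_sum E (- k) n y + spectral_sum E (- k) n (S n - y)).
  apply/funext => n.
  rewrite (_ : nu = - k + s); last by rewrite /k opprB subrK.
  rewrite (spectral_sumM famE) !spectral_sumE (step_opB famE) addrC.
  by rewrite -/(S n) subrK.
apply: cvgD => //.
have Sy0 : (fun n => M * `|S n - y|) @ \oo --> (0 : R).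
  rewrite -(mulr0 M) -(normr0 X) -(subrr y); apply: cvgMl_tmp.
  by apply: cvg_norm; apply: cvgB => //; exact: cvg_cst.
apply/norm_cvg0P; apply: (squeeze_cvgr _ (cvg_cst 0) Sy0).
by exists N => // n nN; rewrite normr_ge0 MN.
Qed.

Lemma lpowB nu x y : hs_dom E nu x -> hs_dom E nu y ->
  hs_dom E nu (x - y) /\ lpow E nu (x - y) = lpow E nu x - lpow E nu y.
Proof.
move=> xn yn; have cv : (fun n => spectral_sum E nu n (x - y)) @ \oo -->
    lpow E nu x - lpow E nu y.
  under eq_fun do rewrite spectral_sumE (step_opB famE).
  exact: (cvgB xn yn).
split; first exact: cvgP cv.
exact: cvg_lim cv.
Qed.

(** The two sides agree already for the sums of each level. *)
Lemma ip_lpow_shift s u q f x : s + s = u + q ->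
  hs_dom E s f -> hs_dom E s x -> hs_dom E u f -> hs_dom E q x ->
  ip (lpow E s f) (lpow E s x) = ip (lpow E u f) (lpow E q x).
Proof.
move=> suq fs xs fu xq.
have c1 := cvg_ip ipE fs xs; have c2 := cvg_ip ipE fu xq.
rewrite -(cvg_lim _ c1)// -(cvg_lim _ c2)//; congr (limn _); apply/funext => n.
rewrite !spectral_sumE !(ip_step_op famE); apply: eq_big_nat => k /andP[k0 _].
have kn : grid n k != 0 :> R by rewrite gt_eqF// grid_gt0.
by rewrite -!powRD ?suq// kn implybT.
Qed.

(** The spectrum is split at [eta]: below it [l^q] is compared with [l^-a],
    above it with [l^s]. *)
Lemma hs_interpolation a q s eta x : 0 < eta -> - a <= q <= s ->
  hs_dom E (- a) x -> hs_dom E q x -> hs_dom E s x ->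
  hs_norm E q x ^+ 2 <=
    (eta `^ (q + a) * hs_norm E (- a) x) ^+ 2
    + (eta `^ (q - s) * hs_norm E s x) ^+ 2.
Proof.
move=> eta0 /andP[aq qs] xa xq xs.
have nsq nu : hs_dom E nu x ->
    (fun n => `|spectral_sum E nu n x| ^+ 2) @ \oo --> hs_norm E nu x ^+ 2.
  move=> xn; apply: (continuous_cvg _ (@exprn_continuous R 2 _)).
  exact: cvg_norm xn.
have pt l : 0 < l -> (l `^ q) ^+ 2 <=
    (eta `^ (q + a) * l `^ (- a)) ^+ 2 + (eta `^ (q - s) * l `^ s) ^+ 2.
  move=> l0; have [le|le] := lerP l eta.
    rewrite -[leLHS]addr0 lerD ?sqr_ge0// lerXn2r ?nnegrE ?mulr_ge0 ?powR_ge0//.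
    have -> : l `^ q = l `^ (q + a) * l `^ (- a).
      by rewrite -powRD ?addrK// (gt_eqF l0) implybT.
    rewrite ler_wpM2r ?powR_ge0// ge0_ler_powR ?nnegrE ?(ltW l0) ?(ltW eta0)//.
    by rewrite -lerBlDr sub0r.
  rewrite -[leLHS]add0r lerD ?sqr_ge0// lerXn2r ?nnegrE ?mulr_ge0 ?powR_ge0//.
  have -> : l `^ q = l `^ (q - s) * l `^ s.
    by rewrite -powRD ?subrK// (gt_eqF l0) implybT.
  rewrite ler_wpM2r ?powR_ge0// -opprB ler_powRN ?(ltW le)//.
  by rewrite subr_ge0.
have sc r nu : hs_dom E nu x ->
    (fun n => r * `|spectral_sum E nu n x| ^+ 2) @ \oo -->
    r * hs_norm E nu x ^+ 2.
  by move=> /nsq; apply: cvgMl_tmp.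
have c : (fun n => eta `^ (q + a) ^+ 2 * `|spectral_sum E (- a) n x| ^+ 2 +
                   eta `^ (q - s) ^+ 2 * `|spectral_sum E s n x| ^+ 2) @ \oo -->
    eta `^ (q + a) ^+ 2 * hs_norm E (- a) x ^+ 2 +
    eta `^ (q - s) ^+ 2 * hs_norm E s x ^+ 2.
  by apply: cvgD; exact: sc.
rewrite !exprMn -(cvg_lim _ c)// -(cvg_lim _ (nsq _ xq))//.
apply: ler_lim; [exact: cvgP (nsq _ xq)|exact: cvgP c|apply: nearW => n /=].
rewrite !spectral_sumE !(norm_step_op ipE famE) !mulr_sumr -big_split/=.
apply: ler_sum_nat => k /andP[k0 _].
apply: le_trans (ler_wpM2r (sqr_ge0 _) (pt _ (grid_gt0 n k0))) _.
by rewrite le_eqVlt; apply/orP; left; apply/eqP; ring.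
Qed.

End HilbertScale.

(** * The index function and its Fenchel conjugate *)

Section IndexFunctions.
Context {R : realType}.
Variables (phi : R -> R) (u s a : R).
Hypothesis phi_index : index_function phi.
Hypothesis phi_concave : concave_on_nonneg phi.
Hypothesis exponent01 : 0 < 2 * (u - s) / (a + u) <= 1.

Lemma index_le x y : 0 <= x -> x <= y -> phi x <= phi y.
Proof.
move=> x0; rewrite le_eqVlt => /predU1P[->//|xy]; have [_ mon _] := phi_index.
by apply/ltW/mon; rewrite // in_itv/= andbT// (le_trans x0)// ltW.
Qed.

Lemma index_ge0 x : 0 <= x -> 0 <= phi x.
Proof. by move=> x0; have [_ _ {1}<-] := phi_index; exact: index_le. Qed.

Lemma index_gt0 x : 0 < x -> 0 < phi x.
Proof.
move=> x0; have [_ mon {1}<-] := phi_index.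
by apply: mon; rewrite // in_itv/= andbT// ltW.
Qed.

(** Concavity between [0] and [k * x]. *)
Lemma index_scale k x : 1 <= k -> 0 <= x -> phi (k * x) <= k * phi x.
Proof.
move=> k1 x0; have k0 : 0 < k by exact: lt_le_trans k1.
have [_ _ phi0] := phi_index.
have kx0 : 0 <= k * x by rewrite mulr_ge0// ltW.
have k01 : 0 <= k^-1 <= 1 by rewrite invr_ge0 (ltW k0) invf_le1.
have := phi_concave kx0 (lexx 0) k01.
rewrite phi0 !mulr0 !addr0 mulKf ?gt_eqF// => h.
by rewrite -(@ler_pM2l _ k^-1) ?invr_gt0// mulKf ?gt_eqF.
Qed.

Local Notation psi := (psi phi u s a).
Local Notation phi_app := (phi_app phi u s a).

Lemma psi_ge0 t : 0 <= psi t. Proof. exact: powR_ge0. Qed.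

Lemma psi_le t t' : t <= t' -> psi t <= psi t'.
Proof.
move=> tt'; have /andP[p0 _] := exponent01.
rewrite /Defs.psi ge0_ler_powR ?(ltW p0) ?nnegrE ?index_ge0 ?sqrtr_ge0//.
by rewrite index_le ?sqrtr_ge0// ler_wsqrtr.
Qed.

Lemma psi1_gt0 : 0 < psi 1.
Proof. by rewrite powR_gt0// index_gt0// sqrtr1. Qed.

(** Concavity of [phi] bounds [phi (k x)] by [k phi x]; the square root in
    [psi] and the exponent, at most 1, keep this linear in [k]. *)
Lemma psi_scale k t : 1 <= k -> 0 <= t -> psi (k ^+ 2 * t) <= k * psi t.
Proof.
move=> k1 t0; have k0 : 0 <= k by exact: le_trans k1.
have /andP[p0 p1] := exponent01.
rewrite /Defs.psi sqrtrM ?sqr_ge0// sqrtr_sqr (ger0_norm k0).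
apply: le_trans (ge0_ler_powR (ltW p0) _ _ (index_scale k1 (sqrtr_ge0 t))) _;
  rewrite ?nnegrE ?mulr_ge0 ?index_ge0 ?mulr_ge0 ?sqrtr_ge0//.
rewrite powRM ?index_ge0 ?sqrtr_ge0// ler_wpM2r ?powR_ge0//.
by apply: ler1_powR.
Qed.

Lemma psi_growth t : 0 <= t -> psi t <= psi 1 * (1 + Num.sqrt t).
Proof.
move=> t0; have c0 := ltW psi1_gt0; have w0 := sqrtr_ge0 t.
have [t1|t1] := lerP t 1.
  by apply: (le_trans (psi_le t1)); rewrite ler_peMr// lerDl.
have w1 : 1 <= Num.sqrt t by rewrite -[leLHS]sqrtr1 ler_wsqrtr// ltW.
have := @psi_scale (Num.sqrt t) 1 w1 ler01.
rewrite mulr1 sqr_sqrtr// => /le_trans; apply.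
by rewrite mulrC ler_wpM2l// lerDr.
Qed.

(** The extended real supremum is finite, because [psi] grows at most like the
    square root; so it can be handled as a real supremum. *)
Lemma phi_app_sup al : 0 < al ->
  (forall t, 0 <= t -> psi t - t / al <= phi_app al) /\
  (forall M, (forall t, 0 <= t -> psi t - t / al <= M) -> phi_app al <= M).
Proof.
move=> al0; rewrite /Defs.phi_app /fenchel.
set S := (X in ereal_sup X).
have Sub M : (forall t, 0 <= t -> psi t - t / al <= M) ->
    (ereal_sup S <= M%:E)%E.
  move=> tM; apply: ge_ereal_sup => _ [t _ <-]; rewrite /extend_pinfty.
  case: ifPn => [t0|_]; last by rewrite /= leNye.
  by rewrite -EFinB lee_fin opprK mulrN addrC tM.
have Slb t : 0 <= t -> ((psi t - t / al)%:E <= ereal_sup S)%E.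
  move=> t0; apply: ereal_sup_ubound; exists t => //.
  by rewrite /extend_pinfty t0 -EFinB opprK mulrN addrC.
have fin : ereal_sup S \is a fin_num.
  have Sle : (ereal_sup S <= (psi 1 + psi 1 ^+ 2 * al)%:E)%E.
    apply: Sub => t t0; have := psi_growth t0; have := sqr_sqrtr t0.
    have := psi1_gt0; have := sqrtr_ge0 t; move: (psi t) (psi 1) (Num.sqrt t).
    move=> p c w w0 c0 <- pw; rewrite lerBlDr; apply: le_trans pw _.
    rewrite mulrDr mulr1 -addrA lerD2l -(ler_pM2r al0) mulrDl divfK ?gt_eqF//.
    have : 0 <= (c * al - w) ^+ 2 by exact: sqr_ge0.
    have : 0 <= c * al * w by rewrite !mulr_ge0// ltW.
    nra.
  rewrite fin_numElt (lt_le_trans _ (Slb 0 (lexx 0))) ?ltNyr//=.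
  by rewrite (le_lt_trans Sle)// ltry.
split => [t /Slb|M /Sub]; last by rewrite -(fineK fin) lee_fin.
by rewrite -[X in (_ <= X)%E](fineK fin) lee_fin.
Qed.

Lemma phi_app_ub al t : 0 < al -> 0 <= t -> psi t <= phi_app al + t / al.
Proof. by move=> /phi_app_sup[+ _] => /[apply]; rewrite lerBlDr. Qed.

(** Near 0 [psi] is at least a multiple of the square root, which exceeds the
    linear term. *)
Lemma phi_app_gt0 al : 0 < al -> 0 < phi_app al.
Proof.
move=> al0; have c0 := psi1_gt0.
pose w := Num.min 1 (al * psi 1 / 2).
have w0 : 0 < w by rewrite lt_min ltr01 !mulr_gt0// invr_gt0.
have w1 : w <= 1 by rewrite ge_min lexx.
have wal : w <= al * psi 1 / 2 by rewrite ge_min lexx orbT.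
have psiw : w * psi 1 <= psi (w ^+ 2).
  have := @psi_scale w^-1 (w ^+ 2) _ (sqr_ge0 w).
  rewrite invf_ge1// -exprMn mulVf ?gt_eqF// expr1n => /(_ w1).
  by rewrite mulrC ler_pdivlMr// mulrC.
have := phi_app_ub al0 (sqr_ge0 w).
have : w ^+ 2 / al <= w * psi 1 / 2.
  rewrite ler_pdivrMr// expr2 -!mulrA ler_pM2l//; apply: (le_trans wal).
  by lra.
have : 0 < w * psi 1 by rewrite mulr_gt0.
lra.
Qed.

Lemma phi_app_le al be : 0 < al -> al <= be -> phi_app al <= phi_app be.
Proof.
move=> al0 albe; have be0 : 0 < be by exact: lt_le_trans albe.
apply: (phi_app_sup al0).2 => t t0; rewrite lerBlDr.
apply: le_trans (phi_app_ub be0 t0) _; rewrite lerD2l ler_wpM2l//.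
by rewrite lef_pV2.
Qed.

(** The substitution [t = k^2 t'] in the supremum. *)
Lemma phi_app_scale k al : 1 <= k -> 0 < al ->
  phi_app (k * al) <= k * phi_app al.
Proof.
move=> k1 al0; have k0 : 0 < k by exact: lt_le_trans k1.
apply: (phi_app_sup (mulr_gt0 k0 al0)).2 => t t0; rewrite lerBlDr.
have t'0 : 0 <= t / k ^+ 2 by rewrite divr_ge0// sqr_ge0.
have := psi_scale k1 t'0; rewrite [_ * (t / _)]mulrC divfK ?expf_neq0 ?gt_eqF//.
move=> /le_trans; apply.
have := phi_app_ub al0 t'0; rewrite -(ler_pM2l k0) => /le_trans; apply.
rewrite mulrDr lerD2l le_eqVlt; apply/orP; left; apply/eqP; field.
by rewrite !gt_eqF.
Qed.

Lemma phi_app_scale_max C al : 0 < al -> 0 < C ->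
  phi_app (C * al) <= (C + 1) * phi_app al.
Proof.
move=> al0 C0; have C1 : 1 <= C + 1 by rewrite lerDr ltW.
apply: le_trans (phi_app_scale C1 al0).
apply: phi_app_le; first exact: mulr_gt0.
by rewrite ler_wpM2r ?(ltW al0)// lerDl.
Qed.

(** For [al <= be], [phi_app al <= phi_app be <= (be / al) phi_app al]. *)
Lemma phi_app_continuous al : 0 < al -> {for al, continuous phi_app}.
Proof.
move=> al0; have f0 := phi_app_gt0 al0.
pose K := 2 * phi_app al / al; have K0 : 0 < K by rewrite !mulr_gt0 ?invr_gt0.
apply/cvgrPdist_le => e e0; near=> be.
have be2 : al / 2 < be.
  have : `|al - be| < al / 2.
    near: be; apply: (@cvgr_dist_lt _ _ _ (nbhs al) _ id); first exact: cvg_id.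
    by rewrite divr_gt0.
  by rewrite ltr_distlC => /andP[+ _]; rewrite {1}(splitr al); lra.
have be0 : 0 < be by rewrite (le_lt_trans _ be2)// divr_ge0// ltW.
have beE : `|al - be| <= e / K.
  near: be; apply: (@cvgr_dist_le _ _ _ (nbhs al) _ id); first exact: cvg_id.
  by rewrite divr_gt0.
suff h : `|phi_app al - phi_app be| <= K * `|al - be|.
  by rewrite (le_trans h)// mulrC -ler_pdivlMr.
have [le|le] := lerP al be.
  rewrite !ler0_norm ?subr_le0 ?phi_app_le// !opprB.
  have k1 : 1 <= be / al by rewrite ler_pdivlMr// mul1r.
  have := phi_app_scale k1 al0; rewrite divfK ?gt_eqF// => h.
  rewrite lerBlDr (le_trans h)//.
  have -> : be / al * phi_app al = phi_app al / al * (be - al) + phi_app al.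
    by field; rewrite gt_eqF.
  rewrite lerD2r ler_wpM2r ?subr_ge0// /K -mulrA.
  by rewrite ler_peMl ?ler1n// divr_ge0// ltW.
rewrite !ger0_norm ?subr_ge0 ?phi_app_le ?(ltW le)//.
have k1 : 1 <= al / be by rewrite ler_pdivlMr// mul1r ltW.
have := phi_app_scale k1 be0; rewrite divfK ?gt_eqF// => h.
rewrite lerBlDr (le_trans h)//.
have -> : al / be * phi_app be = phi_app be / be * (al - be) + phi_app be.
  by field; rewrite gt_eqF.
rewrite lerD2r ler_wpM2r ?subr_ge0 ?(ltW le)// /K.
rewrite ler_pdivrMr// (le_trans (phi_app_le be0 (ltW le)))//.
have -> : 2 * phi_app al / al * be = phi_app al * (2 * be / al) by ring.
by rewrite ler_peMr ?(ltW f0)// ler_pdivlMr//; lra.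
Unshelve. all: by end_near. Qed.

(** [Sigma] and [Sigma_tilde] both have this form. The intermediate value
    theorem is applied between 1 and the solution [x] of the equation with
    [phi_app 1] in place of [phi_app al]; monotonicity of [phi_app] puts [del]
    between the two values. *)
Lemma power_phi_app_surj q del : 0 < q -> 0 < del ->
  exists2 al, 0 < al & al `^ q * Num.sqrt (phi_app al) = del.
Proof.
move=> q0 del0; pose h al := al `^ q * Num.sqrt (phi_app al).
pose w := Num.sqrt (phi_app 1).
have w0 : 0 < w by rewrite sqrtr_gt0 phi_app_gt0.
have h1 : h 1 = w by rewrite /h powR1 mul1r.
pose x := (del / w) `^ q^-1.
have x0 : 0 < x by rewrite powR_gt0// divr_gt0.
have xq : x `^ q * w = del.
  by rewrite /x -powRrM mulVf ?gt_eqF// powRr1 ?divr_ge0 ?(ltW del0) ?(ltW w0)//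
    divfK ?gt_eqF.
have hc (b c : R) : 0 < b -> {within `[b, c], continuous h}.
  move=> b0; apply: continuous_in_subspaceT => y.
  rewrite inE/= in_itv/= => /andP[yb _].
  have y0 : 0 < y by exact: lt_le_trans yb.
  have c1 : {for y, continuous (fun x : R => x `^ q)}.
    apply: differentiable_continuous; apply/derivable1_diffP.
    by apply: derivable_powR; rewrite in_itv/= y0.
  have c2 : {for y, continuous (fun x : R => Num.sqrt (phi_app x))}.
    apply: continuous_comp; first exact: phi_app_continuous.
    exact: sqrt_continuous.
  exact: (cvgM c1 c2).
have [x1|x1] := lerP x 1.
  have [|c] := @IVT _ h x 1 del x1 (hc _ _ x0).
    rewrite ge_min le_max h1 -xq; apply/andP; split.
      apply/orP; left; rewrite ler_wpM2l ?powR_ge0// ler_wsqrtr//.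
      exact: phi_app_le.
    apply/orP; right; rewrite ler_piMl ?(ltW w0)//.
    by rewrite -(powRr0 x) ger_powR ?x0// ltW.
  by rewrite in_itv/= => /andP[xc _]; exists c => //; exact: lt_le_trans xc.
have [|c] := @IVT _ h 1 x del (ltW x1) (hc _ _ ltr01).
  rewrite ge_min le_max h1 -xq; apply/andP; split.
    apply/orP; left; rewrite ler_peMl ?(ltW w0)//.
    by rewrite -(powRr0 x) ler_powR ?(ltW x1)// ltW.
  apply/orP; right; rewrite ler_wpM2l ?powR_ge0// ler_wsqrtr//.
  by rewrite phi_app_le// ltW.
by rewrite in_itv/= => /andP[xc _]; exists c => //; exact: lt_le_trans xc.
Qed.

Lemma inv_posK (h : R -> R) y : (exists2 al, 0 < al & h al = y) ->
  0 < inv_pos h y /\ h (inv_pos h y) = y.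
Proof.
move=> yh; have yi : [set y] `<=` h @` [set al | 0 < al] by move=> _ ->.
split; last by apply: pinvK; rewrite inE; exact: yi.
by apply: (@surjpinv_image_sub _ _ (fun=> 0) _ _ _ yi (inv_pos h y)); exists y.
Qed.

Lemma Sigma_inv del : 0 < del ->
  0 < inv_pos (Sigma phi u s a) del /\
  del ^+ 2 = inv_pos (Sigma phi u s a) del
             * phi_app (inv_pos (Sigma phi u s a) del).
Proof.
move=> del0; have [|al0 E] := @inv_posK (Sigma phi u s a) del.
  have [|al al0 <-] := @power_phi_app_surj 2^-1 del _ del0.
    by rewrite invr_gt0.
  by exists al => //; rewrite /Sigma powR12_sqrt// ltW.
by split => //; rewrite -{1}E exprMn !sqr_sqrtr ?(ltW al0)// ltW ?phi_app_gt0.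
Qed.

Lemma Sigma_tilde_inv theta sig : 0 < theta < 1 -> 0 < sig ->
  0 < inv_pos (Sigma_tilde phi u s a theta) sig /\
  sig ^+ 2 = inv_pos (Sigma_tilde phi u s a theta) sig `^ (2 - theta)
             * phi_app (inv_pos (Sigma_tilde phi u s a theta) sig).
Proof.
move=> /andP[th0 th1] sig0.
have [|al0 E] := @inv_posK (Sigma_tilde phi u s a theta) sig.
  by apply: power_phi_app_surj => //; lra.
split => //; rewrite -{1}E exprMn sqr_sqrtr ?ltW ?phi_app_gt0//.
rewrite -powR_mulrn ?powR_ge0// -powRrM; congr (_ `^ _ * _).
by rewrite mulrBl mul1r divfK.
Qed.

End IndexFunctions.

(** * Absorption inequalities *)

Section Young.
Context {R : realType}.

(** [r] and [sqrt al * e] are at most their sum [m], and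
    [m^theta m^(1-theta) = m]. *)
Lemma young_interpolation (theta al r e : R) : 0 < theta < 1 -> 0 < al ->
  0 <= r -> 0 <= e ->
  r `^ theta * e `^ (1 - theta) <=
    al `^ (- ((1 - theta) / 2)) * (r + Num.sqrt al * e).
Proof.
move=> /andP[th0 th1] al0 r0 e0; have w0 := sqrtr_ge0 al.
have we0 : 0 <= Num.sqrt al * e by rewrite mulr_ge0.
have -> : e `^ (1 - theta) =
    al `^ (- ((1 - theta) / 2)) * (Num.sqrt al * e) `^ (1 - theta).
  rewrite powRM// -powR12_sqrt ?(ltW al0)// -powRrM mulrA -powRD.
    by rewrite [2^-1 * _]mulrC addNr powRr0 mul1r.
  by rewrite (gt_eqF al0) implybT.
rewrite mulrCA ler_wpM2l ?powR_ge0//.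
have -> : r + Num.sqrt al * e =
    (r + Num.sqrt al * e) `^ theta * (r + Num.sqrt al * e) `^ (1 - theta).
  by rewrite -powRD subrKC ?powRr1 ?addr_ge0// oner_eq0.
have th'0 : 0 <= 1 - theta by rewrite subr_ge0 ltW.
apply: ler_pM; rewrite ?powR_ge0//.
  by apply: (ge0_ler_powR (ltW th0)); rewrite ?nnegrE ?addr_ge0// lerDl.
by apply: (ge0_ler_powR th'0); rewrite ?nnegrE ?addr_ge0// lerDr.
Qed.

Lemma powR_sqrE (al x : R) : 0 < al -> (al `^ x) ^+ 2 = al `^ (2 * x).
Proof. by move=> al0; rewrite -powR_mulrn ?powR_ge0// -powRrM mulrC. Qed.

End Young.

Section ErrorBound.
Context {R : realType}.
Variables (phi : R -> R) (u s a : R).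
Hypothesis phi_index : index_function phi.
Hypothesis phi_concave : concave_on_nonneg phi.
Hypothesis exponent01 : 0 < 2 * (u - s) / (a + u) <= 1.

Local Notation psi := (psi phi u s a).
Local Notation phi_app := (phi_app phi u s a).

(** Absorption of the right-hand side: the residual [r] and the error [e] occur
    there with factors small enough to be moved to the left, once [psi] has
    been replaced by its majorant [phi_app be + r^2 / be] with [be = 8 B al]. *)
Lemma error_absorption (theta k B al del sig r e : R) : 0 < theta < 1 ->
  0 <= k -> 0 < B -> 0 < al -> 0 <= sig -> 0 <= r -> 0 <= e ->
  r ^+ 2 / 2 + al * e ^+ 2 <=
    del * r + sig * (k * (r `^ theta * e `^ (1 - theta)))
    + al * (e ^+ 2 / 2 + B * psi (r ^+ 2)) ->
  e ^+ 2 <= (16 + 20 * k ^+ 2 + 4 * B * (8 * B + 1)) *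
    (del ^+ 2 / al + sig ^+ 2 * al `^ (theta - 2) + phi_app al).
Proof.
move=> th k0 B0 al0 sig0 r0 e0 main.
have young := young_interpolation th al0 r0 e0.
pose M := sig * k * al `^ (- ((1 - theta) / 2)).
have noise : sig * (k * (r `^ theta * e `^ (1 - theta))) <=
    M * r + M * (Num.sqrt al * e).
  by rewrite -mulrDr /M -!mulrA !ler_wpM2l.
have M2 : M ^+ 2 = k ^+ 2 * (sig ^+ 2 * al `^ (theta - 2)) * al.
  have : al `^ (theta - 2 + 1) = al `^ (theta - 2) * al `^ 1.
    by rewrite powRD// (gt_eqF al0) implybT.
  rewrite powRr1 ?(ltW al0)// => powE.
  rewrite /M !exprMn powR_sqrE// (_ : 2 * _ = theta - 2 + 1); last by field.
  by rewrite powE; ring.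
have BB0 : 0 < 8 * B by rewrite mulr_gt0.
have psile : al * (B * psi (r ^+ 2)) <= r ^+ 2 / 8
    + al * (B * (8 * B + 1) * phi_app al).
  have BBal0 := mulr_gt0 BB0 al0.
  have := phi_app_ub phi_index phi_concave exponent01 BBal0 (sqr_ge0 r).
  have := phi_app_scale_max phi_index phi_concave exponent01 al0 BB0.
  move=> h1 h2; have := lerD h1 (lexx (r ^+ 2 / (8 * B * al))).
  move/(le_trans h2); rewrite -(ler_pM2l (mulr_gt0 al0 B0)) => h.
  rewrite mulrA (le_trans h)// le_eqVlt; apply/orP; left; apply/eqP.
  by field; rewrite (gt_eqF al0) (gt_eqF B0).
have we2 : (Num.sqrt al * e) ^+ 2 = al * e ^+ 2.
  by rewrite exprMn sqr_sqrtr// ltW.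
(* Young's inequality for [del * r], [M * r] and [M * (sqrt al * e)] *)
have t1 : 0 <= (r / 4 - 2 * del) ^+ 2 by exact: sqr_ge0.
have t2 : 0 <= (r / 4 - 2 * M) ^+ 2 by exact: sqr_ge0.
have t3 : 0 <= (Num.sqrt al * e / 2 - M) ^+ 2 by exact: sqr_ge0.
pose x := del ^+ 2 / al; pose y := sig ^+ 2 * al `^ (theta - 2).
have x0 : 0 <= x by rewrite divr_ge0 ?sqr_ge0// ltW.
have y0 : 0 <= y by rewrite mulr_ge0 ?sqr_ge0 ?powR_ge0.
have f0 := ltW (phi_app_gt0 phi_index phi_concave exponent01 al0).
have delE : del ^+ 2 = al * x by rewrite /x mulrC divfK ?gt_eqF.
have sum : e ^+ 2 <=
    16 * x + 20 * k ^+ 2 * y + 4 * B * (8 * B + 1) * phi_app al.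
  rewrite -/y in M2; rewrite -(ler_pM2l al0).
  clearbody M x y; clear young.
  move: main noise psile t1 t2 t3.
  set w := Num.sqrt al * e in we2 *; set p := phi_app al.
  move: (r `^ theta * _) (psi _) => ye ps main noise psile t1 t2 t3.
  have -> : al * (16 * x + 20 * k ^+ 2 * y + 4 * B * (8 * B + 1) * p) =
      16 * del ^+ 2 + 20 * M ^+ 2 + 4 * (al * (B * (8 * B + 1) * p)).
    by rewrite delE M2; ring.
  have : al * (e ^+ 2 / 2 + B * ps) = w ^+ 2 / 2 + al * (B * ps).
    by rewrite we2; ring.
  move: main; rewrite -we2 => main mainE; rewrite {}mainE in main.
  clear delE M2 we2; clearbody w; move: noise psile main.
  move: (sig * _) (al * (B * ps)) (al * _) => N P Q noise psile main.
  have := sqr_ge0 r; lra.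
rewrite -/x -/y; apply: (le_trans sum).
have c2 : 0 <= k ^+ 2 by exact: sqr_ge0.
have c3 : 0 <= B * (8 * B + 1).
  by rewrite mulr_ge0 ?addr_ge0 ?(ltW BB0) ?(ltW B0).
have p1 := mulr_ge0 c2 x0; have p2 := mulr_ge0 c3 x0.
have p3 := mulr_ge0 c3 y0; have p4 := mulr_ge0 c2 f0.
lra.
Qed.

(** Here [D], [A], [e] are the norms of the error of order [2 s - u], [- a] and
    [s]. With [h^2 = psi (r^2)], the level [eta] for which [eta^(s-u) = h] turns
    the interpolation inequality into [D <= K h^2 + h e]. *)
Lemma smoothness_bound (G K r A D e : R) :
  0 < r -> - a < s -> s < u -> 0 <= G -> 0 <= K -> 0 <= A -> 0 <= D -> 0 <= e ->
  (forall eta, 0 < eta -> D ^+ 2 <=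
     (eta `^ (2 * s - u + a) * A) ^+ 2 + (eta `^ (2 * s - u - s) * e) ^+ 2) ->
  A <= K * phi r ->
  2 * (G * D) <= e ^+ 2 / 2 + (2 * G * K + 2 * G ^+ 2) * psi (r ^+ 2).
Proof.
move=> r0 as0 su G0 K0 A0 D0 e0 hD AK.
have f0 : 0 < phi r by exact: index_gt0.
have au : a + u != 0 by rewrite gt_eqF; lra.
pose h := phi r `^ ((u - s) / (a + u)).
have h0 : 0 <= h by exact: powR_ge0.
have psiE : psi (r ^+ 2) = h ^+ 2.
  rewrite /Defs.psi sqrtr_sqr gtr0_norm// /h powR_sqrE//; congr (_ `^ _).
  by rewrite mulrA.
have := hD (phi r `^ (- (a + u)^-1)) (powR_gt0 _ f0).
rewrite -!powRrM.
have -> : - (a + u)^-1 * (2 * s - u - s) = (u - s) / (a + u) by field.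
rewrite -/h => hD'.
have E1 : phi r `^ (- (a + u)^-1 * (2 * s - u + a)) * A <= K * h ^+ 2.
  apply: (le_trans (ler_wpM2l (powR_ge0 _ _) AK)).
  have -> : h ^+ 2 = phi r `^ (- (a + u)^-1 * (2 * s - u + a)) * phi r.
    have : phi r `^ (- (a + u)^-1 * (2 * s - u + a) + 1) =
        phi r `^ (- (a + u)^-1 * (2 * s - u + a)) * phi r `^ 1.
      by rewrite powRD// (gt_eqF f0) implybT.
    rewrite powRr1 ?(ltW f0)// => <-; rewrite /h powR_sqrE//.
    by congr (_ `^ _); field.
  by rewrite mulrCA.
have DE : D <= K * h ^+ 2 + h * e.
  rewrite -(@ler_pXn2r _ 2) ?nnegrE ?addr_ge0 ?mulr_ge0 ?sqr_ge0//.
  apply: (le_trans hD').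
  apply: (@le_trans _ _ ((K * h ^+ 2) ^+ 2 + (h * e) ^+ 2)).
    by rewrite lerD2r lerXn2r ?nnegrE ?mulr_ge0 ?powR_ge0 ?sqr_ge0.
  by rewrite sqrrD lerD2r lerDl mulrn_wge0// !mulr_ge0// sqr_ge0.
rewrite psiE.
have := ler_wpM2l G0 DE; have : 0 <= (e - 2 * G * h) ^+ 2 by exact: sqr_ge0.
by lra.
Qed.

End ErrorBound.

(** * The error of a Tikhonov minimizer *)

Lemma hs_enorm_dom {R : realType} {X : completeNormedModType R}
    (E : R -> X -> X) nu x :
  hs_dom E nu x -> hs_enorm E nu x = (hs_norm E nu x)%:E.
Proof. by move=> xn; rewrite /hs_enorm asboolT. Qed.

(** Adding [|F fdag|^2/2] completes the square in the data misfit. *)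
Lemma tikhonov_comparison {R : realType} {X Y : completeNormedModType R}
    (ipY : {dot Y for idfun}) (hY : is_hilbert ipY) (E : R -> X -> X) s
    (F : X -> Y) fdag f xi del sig z al :
  hs_dom E s f -> hs_dom E s fdag ->
  let J := tikhonov E s F (observed ipY (F fdag) xi del sig z) al in
  (J f <= J fdag)%E ->
  `|F f - F fdag| ^+ 2 / 2 + al * (hs_norm E s f ^+ 2 - hs_norm E s fdag ^+ 2)
  <= del * ipY (F f - F fdag) xi + sig * (z (F f) - z (F fdag)).
Proof.
move=> fs fds J; rewrite /J /tikhonov !hs_enorm_dom//.
rewrite -!EFin_expe -!EFinM -!EFinD lee_fin /observed => h.
have nE : `|F f - F fdag| ^+ 2 =
    `|F f| ^+ 2 - 2 * ipY (F fdag) (F f) + `|F fdag| ^+ 2.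
  by rewrite (normD_sqr hY) linearNr/= normrN (ip_sym ipY (F f)); ring.
have gE : ipY (F fdag) (F fdag) = `|F fdag| ^+ 2 by rewrite hY.
rewrite nE linearBl/=; move: h; rewrite gE.
lra.
Qed.

Lemma linear_functional_bounded {R : realType} {V : completeNormedModType R}
    (zeta : {linear V -> R^o}) : continuous zeta ->
  exists2 M : R, 0 <= M & forall v, `|zeta v| <= M * `|v|.
Proof.
move=> /(_ 0)/continuous_linear_bounded/linear_boundedP[M [_ MP]].
exists (`|M| + 1) => [|v]; first by rewrite addr_ge0.
by apply: MP; rewrite (le_lt_trans (ler_norm M))// ltrDl.
Qed.

Section TikhonovError.
Context {R : realType} {X Y V : completeNormedModType R}.
Variables (ipX : {dot X for idfun}) (ipY : {dot Y for idfun}).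
Variable ipV : {dot V for idfun}.
Hypotheses (hX : is_hilbert ipX) (hY : is_hilbert ipY).
Variables (DL : set X) (L : X -> X).
Hypothesis hL : scale_generator ipX DL L.
Variable E : R -> X -> X.
Hypothesis hE : spectral_family_of ipX E DL L.
Variables (DF : set X) (F : X -> Y) (fdag : X) (a s u : R).
Hypothesis basic : basic_assumption ipX ipY E DF F fdag a s u.
Variables (phi : R -> R) (Q : set X).
Hypothesis stab : conditional_stability E DF F fdag a phi Q.
Variables (iota : {linear V -> Y}) (theta rho : R).
Hypothesis stoch : stochastic_assumption ipV E DF F fdag iota s theta rho.

Lemma exponent_bounds : 0 < 2 * (u - s) / (a + u) <= 1.
Proof.
have := basic_s basic; have := basic_us basic; have := basic_as basic.
have := basic_a basic => a0 as0 us /andP[s0 su].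
have au : 0 < a + u by lra.
by rewrite divr_gt0//= ?ler_pdivrMr//; lra.
Qed.

(** The cross term between [fdag] and the error is traded, through the
    smoothness of [fdag], for a norm of order [2 s - u] of the error, which
    interpolates between the orders [- a] and [s]. *)
Lemma tikhonov_error (xi : Y) (z : Y -> R) (zeta : {linear V -> R^o}) :
  `|xi| <= 1 -> continuous zeta ->
  (forall y v, z (y + iota v) = z y + zeta v) ->
  exists2 C : R, 0 <= C & forall del sig al f, 0 <= del -> 0 <= sig -> 0 < al ->
    argmin DF (tikhonov E s F (observed ipY (F fdag) xi del sig z) al) f ->
    hs_ball E DF s rho fdag f -> Q f ->
    hs_norm E s (f - fdag) ^+ 2 <=
      C * (del ^+ 2 / al + sig ^+ 2 * al `^ (theta - 2) + phi_app phi u s a al).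
Proof.
move=> xi1 /linear_functional_bounded[M M0 zetaM] zE.
have th := stochastic_theta stoch.
have [Ci interp] := stochastic_interpolation stoch.
have [K K0 stabK] := stability_estimate stab.
have phi_index := stability_index stab.
have phi_concave := stability_concave stab.
have p01 := exponent_bounds.
have /andP[_ su] := basic_s basic; have as0 := basic_as basic.
have us := basic_us basic.
have [famE _ _] := hE.
have [m m0 Em] := spectral_bottom hX hL hE.
have lower nu x := @hs_dom_lt _ _ _ hX _ famE _ m0 Em nu s x.
have fdu := basic_smooth basic.
have fds : hs_dom E s fdag by exact: (hs_dom_lt hX famE m0 Em su).
pose G := hs_norm E u fdag; have G0 : 0 <= G by exact: normr_ge0.
pose k := M * `|Ci|; have k0 : 0 <= k by rewrite mulr_ge0.
(* the summand 1 keeps the constant positive when [G = 0] *)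
pose B := 2 * G * K + 2 * G ^+ 2 + 1.
have B'0 : 0 <= 2 * G * K + 2 * G ^+ 2.
  by rewrite addr_ge0 ?mulr_ge0 ?sqr_ge0// ltW.
have B0 : 0 < B by rewrite /B ltr_wpDl.
exists (16 + 20 * k ^+ 2 + 4 * B * (8 * B + 1)) => [|del sig al f].
  have : 0 <= B * (8 * B + 1).
    by rewrite mulr_ge0 ?(ltW B0)// addr_ge0// mulr_ge0// ltW.
  have := sqr_ge0 k; lra.
move=> del0 sig0 al0 [DFf /(_ _ (basic_sol basic)) Jf] fball Qf.
have fs : hs_dom E s f by case: fball => -[].
have [xs xE] := lpowB famE fs fds.
set x := f - fdag in xs xE *.
set e := hs_norm E s x; have e0 : 0 <= e by exact: normr_ge0.
pose r := `|F f - F fdag|; have r0 : 0 <= r by exact: normr_ge0.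
apply: (@error_absorption _ _ _ _ _ phi_index phi_concave p01 theta k B al del
  sig r) => //.
have q_lt : 2 * s - u < s by lra.
have a_lt : - a < s by [].
have xq := lower _ _ q_lt xs; have xa := lower _ _ a_lt xs.
pose q := 2 * s - u.
have cross : - (2 * ipX (lpow E s fdag) (lpow E s x)) <=
    2 * (G * hs_norm E q x).
  rewrite (@ip_lpow_shift _ _ _ hX _ famE s u q)//; last by rewrite /q; lra.
  rewrite -mulrN ler_pM2l// -linearNl/= (le_trans (ip_le_norm hX _ _))//.
  by rewrite normrN.
have smooth : 2 * (G * hs_norm E q x) <=
    e ^+ 2 / 2 + (2 * G * K + 2 * G ^+ 2) * psi phi u s a (r ^+ 2).
  have D0 : 0 <= hs_norm E q x by exact: normr_ge0.
  (* at [r = 0] there is no level to split at, but then [f = fdag] *)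
  move: r0; rewrite le_eqVlt => /predU1P[r00|r0].
    have xx : x = 0.
      rewrite /x (basic_unique basic DFf) ?subrr//.
      by apply/eqP; rewrite -subr_eq0 -normr_le0 -/r -r00.
    have -> : hs_norm E q x = 0.
      have [_] := lpowB famE xq xq; rewrite subrr -{1}xx /hs_norm => ->.
      by rewrite subrr normr0.
    by rewrite mulr0 mulr0 addr_ge0 ?divr_ge0 ?sqr_ge0// mulr_ge0// psi_ge0.
  apply: (@smoothness_bound _ _ _ _ _ phi_index G K r (hs_norm E (- a) x)) =>
    //; [exact: ltW|exact: normr_ge0| |exact: stabK].
  move=> eta eta0; apply: (hs_interpolation hX famE) => //.
  by apply/andP; split; rewrite /q; lra.
have cmp := tikhonov_comparison hY fs fds Jf.
have fE : lpow E s f = lpow E s fdag + lpow E s x by rewrite xE subrKC.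
have normE : hs_norm E s f ^+ 2 - hs_norm E s fdag ^+ 2 =
    2 * ipX (lpow E s fdag) (lpow E s x) + e ^+ 2.
  by rewrite {1}/hs_norm fE (normD_sqr hX) /e /hs_norm; ring.
have xi_le : ipY (F f - F fdag) xi <= r.
  by rewrite (le_trans (ip_le_norm hY _ _))// ler_piMr.
have z_le : z (F f) - z (F fdag) <= k * (r `^ theta * e `^ (1 - theta)).
  have [v vE vle] := interp f fball.
  have -> : F f = F fdag + iota v by rewrite vE subrKC.
  rewrite zE addrAC subrr add0r (le_trans (ler_norm _))//.
  rewrite (le_trans (zetaM v))//.
  rewrite /k -mulrA ler_wpM2l//; apply: (le_trans vle); rewrite -mulrA.
  by rewrite ler_wpM2r ?mulr_ge0 ?powR_ge0// ler_norm.
have Psi0 := psi_ge0 phi u s a (r ^+ 2).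
have h1 := ler_wpM2l del0 xi_le; have h2 := ler_wpM2l sig0 z_le.
have h3 : al * (e ^+ 2 - (e ^+ 2 / 2 + B * psi phi u s a (r ^+ 2))) <=
    al * (hs_norm E s f ^+ 2 - hs_norm E s fdag ^+ 2).
  rewrite ler_pM2l// normE /B [_ * psi _ _ _ _ _]mulrDl mul1r.
  move: cross smooth Psi0.
  by move: (_ * psi _ _ _ _ _) (2 * ipX _ _) => A I; lra.
move: cmp; rewrite -/r mulrBr in h3 *.
by lra.
Qed.

End TikhonovError.

(** * The parameter choice *)

Section ParameterChoice.
Context {R : realType}.
Variables (phi : R -> R) (u s a theta : R).
Hypothesis phi_index : index_function phi.
Hypothesis phi_concave : concave_on_nonneg phi.
Hypothesis exponent01 : 0 < 2 * (u - s) / (a + u) <= 1.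
Hypothesis theta01 : 0 < theta < 1.

(** Each of the two summands of [ast] makes one noise term equal to [phi_app];
    since [phi_app] is increasing and grows at most linearly, passing to the
    larger [ast] and to a comparable [al] costs only constants. *)
Lemma parameter_choice_rate c C del sig al :
  let ast := inv_pos (Sigma phi u s a) del
             + inv_pos (Sigma_tilde phi u s a theta) sig in
  0 < c -> 0 < C -> 0 < del -> 0 < sig -> c <= al / ast <= C ->
  del ^+ 2 / al + sig ^+ 2 * al `^ (theta - 2) + phi_app phi u s a al <=
    (c^-1 + c `^ (theta - 2) + (C + 1)) * phi_app phi u s a ast.
Proof.
move=> ast c0 C0 del0 sig0 /andP[cal alC].
have [a1 delE] := Sigma_inv phi_index phi_concave exponent01 del0.
have [a2 sigE] := Sigma_tilde_inv phi_index phi_concave exponent01 theta01 sig0.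
have ast0 : 0 < ast by rewrite addr_gt0.
move: cal alC; rewrite ler_pdivlMr// ler_pdivrMr// => cal alC.
have al0 : 0 < al by rewrite (lt_le_trans _ cal)// mulr_gt0.
have f0 := phi_app_gt0 phi_index phi_concave exponent01 ast0.
have mono := phi_app_le phi_index phi_concave exponent01.
have le1 : inv_pos (Sigma phi u s a) del <= ast by rewrite lerDl ltW.
have le2 : inv_pos (Sigma_tilde phi u s a theta) sig <= ast.
  by rewrite lerDr ltW.
have thE : theta - 2 = - (2 - theta) by rewrite opprB.
have q0 : 0 <= 2 - theta by move: theta01 => /andP[]; lra.
rewrite !mulrDl; apply: lerD; first apply: lerD.
- rewrite delE ler_pdivrMr// mulrAC.
  have -> : c^-1 * al * phi_app phi u s a ast = al / c * phi_app phi u s a ast.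
    by rewrite [c^-1 * _]mulrC.
  have le1al : inv_pos (Sigma phi u s a) del <= al / c.
    by rewrite ler_pdivlMr// mulrC (le_trans _ cal)// ler_wpM2l// ltW.
  apply: ler_pM; [exact: ltW| |exact: le1al|exact: mono].
  exact/ltW/(phi_app_gt0 phi_index phi_concave exponent01 a1).
- rewrite sigE thE.
  have al_le : al `^ (- (2 - theta)) <= (c * ast) `^ (- (2 - theta)).
    by rewrite ler_powRN// mulr_gt0.
  have ast_c : ast `^ (2 - theta) * (c * ast) `^ (- (2 - theta)) =
      c `^ (- (2 - theta)).
    rewrite powRM ?(ltW c0) ?(ltW ast0)// mulrCA [ast `^ (- _)]powRN.
    by rewrite mulfV ?mulr1// gt_eqF// powR_gt0.
  rewrite -ast_c [_ * phi_app _ _ _ _ _ in leRHS]mulrAC.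
  apply: ler_pM; rewrite ?mulr_ge0 ?powR_ge0//.
    exact/ltW/(phi_app_gt0 phi_index phi_concave exponent01 a2).
  apply: ler_pM; rewrite ?powR_ge0 ?mono//.
    exact/ltW/(phi_app_gt0 phi_index phi_concave exponent01 a2).
  by rewrite ge0_ler_powR ?nnegrE ?(ltW a2) ?(ltW ast0).
- rewrite -mulrDl; apply: (@le_trans _ _ (phi_app phi u s a (C * ast))).
    exact: mono.
  exact: phi_app_scale_max.
Qed.

End ParameterChoice.

Lemma vanishing_noise_near {R : realType} (sigma0 delta0 : R) :
  0 < sigma0 -> 0 < delta0 ->
  \forall p \near @vanishing_noise R, 0 < p.1 <= delta0 /\ 0 < p.2 <= sigma0.
Proof.
move=> s0 d0; rewrite /vanishing_noise /within/=; apply/nbhs_ballP.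
exists (Num.min delta0 sigma0); first by rewrite /= lt_min s0 d0.
move=> [del sig] [/= b1 b2] [del0 sig0]; rewrite del0 sig0/=.
move: b1 b2; rewrite /ball/= !sub0r !normrN !gtr0_norm// !lt_min.
by move=> /andP[/ltW-> _] /andP[_ /ltW->].
Qed.

Theorem corollary3 (R : realType)
  (X Y V : completeNormedModType R)
  (ipX : {dot X for idfun}) (ipY : {dot Y for idfun}) (ipV : {dot V for idfun})
  (hX : is_hilbert ipX) (hY : is_hilbert ipY) (hV : is_hilbert ipV)
  (sepX : separable X) (sepY : separable Y)
  (infX : infinite_dimensional X) (infY : infinite_dimensional Y)
  (DL : set X) (L : X -> X) (hL : scale_generator ipX DL L)
  (E : R -> X -> X) (hE : spectral_family_of ipX E DL L)
  (DF : set X) (F : X -> Y) (fdag : X) (a s u : R)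
  (ill : locally_ill_posed DF F fdag)
  (basic : basic_assumption ipX ipY E DF F fdag a s u)
  (phi : R -> R) (Q : set X)
  (stab : conditional_stability E DF F fdag a phi Q)
  (iota : {linear V -> Y}) (theta rho : R)
  (stoch : stochastic_assumption ipV E DF F fdag iota s theta rho)
  (d : measure_display) (T : measurableType d) (P : probability T R)
  (Z : Y -> {RV P >-> R})
  (hZ : hilbert_process Z) (Zcentered : centered Z) (Zwhite : white ipY Z)
  (Zgaussian : gaussian Z)
  (z : T -> Y -> R) (hz : pathwise_version iota Z z)
  (xi : Y) (hxi : `|xi| <= 1)
  (alpha : R * R -> R)
  (alpha_gt0 : forall delta sigma : R, 0 < delta -> 0 < sigma ->
     0 < alpha (delta, sigma))
  (fhat : R * R -> T -> X)
  (hfhat : {ae P, forall w, forall delta sigma : R, 0 < delta -> 0 < sigma ->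
     argmin DF
       (tikhonov E s F (observed ipY (F fdag) xi delta sigma (z w))
          (alpha (delta, sigma)))
       (fhat (delta, sigma) w)})
  (halpha : same_order vanishing_noise alpha
     (fun p => inv_pos (Sigma phi u s a) p.1
               + inv_pos (Sigma_tilde phi u s a theta) p.2))
  (sigma0 delta0 : R) (sigma0_gt0 : 0 < sigma0) (delta0_gt0 : 0 < delta0)
  (hball : {ae P, forall w, forall delta sigma : R,
     0 < sigma <= sigma0 -> 0 < delta <= delta0 ->
     hs_ball E DF s rho fdag (fhat (delta, sigma) w) /\
     Q (fhat (delta, sigma) w)}) :
  {ae P, forall w,
    (fun p => hs_norm E s (fhat p w - fdag) : R^o) =O_vanishing_noise
    (fun p => Num.sqrt (phi_app phi u s a
                (inv_pos (Sigma phi u s a) p.1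
                 + inv_pos (Sigma_tilde phi u s a theta) p.2)) : R^o)}.
Proof.
have phi_index := stability_index stab.
have phi_concave := stability_concave stab.
have p01 := exponent_bounds basic; have th := stochastic_theta stoch.
have [c [C [c0 C0 halphaP]]] := halpha.
apply: filterS3 hz.2 hfhat hball => w [zeta [zeta_cont _ zetaE]] fmin fball.
have [B B0 BP] :=
  tikhonov_error hX hY hL hE basic stab stoch hxi zeta_cont zetaE.
pose D := B * (c^-1 + c `^ (theta - 2) + (C + 1)).
have D0 : 0 <= D.
  by rewrite mulr_ge0// !addr_ge0 ?invr_ge0 ?powR_ge0 ?ltW.
apply/eqO_exP; exists (Num.sqrt D + 1).
  by rewrite ltr_wpDl// sqrtr_ge0.
apply: filterS2 (vanishing_noise_near sigma0_gt0 delta0_gt0) halphaP.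
move=> [del sig] /= [/andP[del0 deld] /andP[sig0 sigs]] ap.
have al0 := alpha_gt0 _ _ del0 sig0.
have [fb Qf] : hs_ball E DF s rho fdag (fhat (del, sig) w) /\
    Q (fhat (del, sig) w).
  by apply: fball; rewrite ?sig0 ?del0.
have := BP _ _ _ _ (ltW del0) (ltW sig0) al0 (fmin _ _ del0 sig0) fb Qf.
have := parameter_choice_rate phi_index phi_concave p01 th c0 C0 del0 sig0 ap.
move=> /(ler_wpM2l B0) h /le_trans /(_ h); rewrite mulrA -/D => {}h.
rewrite [`|Num.sqrt _|]ger0_norm ?sqrtr_ge0//.
rewrite [leLHS]ger0_norm; last exact: normr_ge0.
set g := phi_app _ _ _ _ _ in h *.
apply: (@le_trans _ _ (Num.sqrt (D * g))).
  by rewrite -[leLHS]ger0_norm ?normr_ge0// -sqrtr_sqr ler_wsqrtr.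
by rewrite sqrtrM// ler_wpM2r ?sqrtr_ge0// lerDl.
Qed.
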